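(* Let $f:\mathbb{X}\to\mathbb{R}$ be a finite measurable function and $q$ a fixed integer. If $\limsup_n B_n^qf<+\infty$ $\mu$-a.e. on a set of positive measure, then there is $c\in\mathbb{R}\cup\{-\infty\}$ with $$\lim_n A_n^+f=\lim_n A_n^-f=\lim_n B_nf=\lim_n B_n^qf=c\quad\mu\text{-a.e. on }\mathbb{X}.$$ Moreover, a.e. convergence of $B_nf$ and a.e. convergence of $B_n^qf$ are equivalent.
   Context: Standing assumptions: $(\mathbb{X},\mathcal{X},\mu,T)$ is a probability space with $T$ an invertible, bi-measurable, measure-preserving, ergodic transformation. For measurable $f:\mathbb{X}\to\mathbb{R}$: $A_n^+f=\frac1n\sum_{i=0}^{n-1}f\circ T^i$, $A_n^-f=\frac1n\sum_{i=0}^{n-1}f\circ T^{-i}$, $B_nf=\frac{1}{2n+1}\sum_{i=-n}^{n}f\circ T^i$, and for a fixed integer $q$, the asymmetric bilateral averages $B_n^qf=\frac{1}{2n+1+q}\sum_{i=-n}^{n+q}f\circ T^i$ (defined for $n$ large enough that $2n+1+q>0$). *)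

(* Defs.v *)
From Stdlib Require Import Reals Lra Lia ZArith.
Open Scope R_scope.

Section Defs.
Context {X : Type}.

Definition sigma_algebra (M : (X -> Prop) -> Prop) : Prop :=
  M (fun _ => True) /\
  (forall A, M A -> M (fun x => ~ A x)) /\
  (forall A : nat -> X -> Prop, (forall n, M (A n)) -> M (fun x => exists n, A n x)).

Definition probability_measure (M : (X -> Prop) -> Prop) (mu : (X -> Prop) -> R) : Prop :=
  (forall A, M A -> 0 <= mu A) /\
  mu (fun _ => True) = 1 /\
  (forall A : nat -> X -> Prop,
     (forall n, M (A n)) ->
     (forall n m x, n <> m -> A n x -> A m x -> False) ->
     infinite_sum (fun n => mu (A n)) (mu (fun x => exists n, A n x))).

Definition measurable_fun (M : (X -> Prop) -> Prop) (f : X -> R) : Prop :=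
  forall a : R, M (fun x => f x < a).

Definition measurable_map (M : (X -> Prop) -> Prop) (S : X -> X) : Prop :=
  forall A, M A -> M (fun x => A (S x)).

Definition invertible_mpt (M : (X -> Prop) -> Prop) (mu : (X -> Prop) -> R)
  (T Tinv : X -> X) : Prop :=
  (forall x, T (Tinv x) = x) /\ (forall x, Tinv (T x) = x) /\
  measurable_map M T /\ measurable_map M Tinv /\
  (forall A, M A -> mu (fun x => A (T x)) = mu A).

Definition ergodic (M : (X -> Prop) -> Prop) (mu : (X -> Prop) -> R) (T : X -> X) : Prop :=
  forall A, M A -> (forall x, A (T x) <-> A x) -> mu A = 0 \/ mu A = 1.

Definition ae (M : (X -> Prop) -> Prop) (mu : (X -> Prop) -> R) (P : X -> Prop) : Prop :=
  exists N, M N /\ mu N = 0 /\ forall x, ~ N x -> P x.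

Definition iterZ (T Tinv : X -> X) (i : Z) (x : X) : X :=
  match i with
  | Z0 => x
  | Zpos p => Nat.iter (Pos.to_nat p) T x
  | Zneg p => Nat.iter (Pos.to_nat p) Tinv x
  end.

Fixpoint sumn (n : nat) (g : nat -> R) : R :=
  match n with
  | O => 0
  | S m => sumn m g + g m
  end.

(* A_n^+ f (x) = (1/n) sum_{i=0}^{n-1} f(T^i x)   (meaningful for n >= 1) *)
Definition Aplus (T Tinv : X -> X) (f : X -> R) (n : nat) (x : X) : R :=
  / INR n * sumn n (fun i => f (iterZ T Tinv (Z.of_nat i) x)).

Definition Aminus (T Tinv : X -> X) (f : X -> R) (n : nat) (x : X) : R :=
  / INR n * sumn n (fun i => f (iterZ T Tinv (- Z.of_nat i) x)).

Definition Bsym (T Tinv : X -> X) (f : X -> R) (n : nat) (x : X) : R :=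
  / INR (2 * n + 1) *
  sumn (2 * n + 1) (fun k => f (iterZ T Tinv (Z.of_nat k - Z.of_nat n) x)).

(* B_n^q f (x) = (1/(2n+1+q)) sum_{i=-n}^{n+q} f(T^i x)
   (meaningful when 2n+1+q > 0; the finitely many other values are irrelevant) *)
Definition Bq (T Tinv : X -> X) (f : X -> R) (q : Z) (n : nat) (x : X) : R :=
  / IZR (2 * Z.of_nat n + 1 + q) *
  sumn (Z.to_nat (2 * Z.of_nat n + 1 + q))
       (fun k => f (iterZ T Tinv (Z.of_nat k - Z.of_nat n) x)).

End Defs.

Inductive ExtR : Type := EFin (r : R) | EMinf | EPinf.

Definition tends_to (u : nat -> R) (l : ExtR) : Prop :=
  match l with
  | EFin c => Un_cv u c
  | EMinf => forall A : R, exists N : nat, forall n, (n >= N)%nat -> u n <= A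
  | EPinf => forall A : R, exists N : nat, forall n, (n >= N)%nat -> A <= u n
  end.

Definition limsup_lt_pinf (u : nat -> R) : Prop :=
  exists (A : R) (N : nat), forall n, (n >= N)%nat -> u n <= A.

(* Main.v *)
(** Write [S n] for the forward and [S' n] for the backward Birkhoff sums of [f].

    Upper bound. Suppose that the bilateral sums centred at the points of a set [E] of positive
    measure are at most [a] times their length; subtracting [a] from [f] we take [a = 0]. Each
    visit of an orbit to [E] reflects the sequence [S]: values to the right of the visit are at
    most their mirror images on the left. By ergodicity the visits are relatively dense up to
    a set of small density, and [S] varies little over bounded distances up to a set of small
    density; comparing the reflections of [0] and of [n] in a common point gives
    [S n <= const]. So both one-sided averages have upper limit at most [a], and, taking [c]
    to be the infimum of the admissible [a], the upper limits of all averages equal [c].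

    Lower bound. For finite [c], say [c = 0], and [d > 0], the function
    [g = sup_n (S n - d n)] is finite and [f - d = g - g o T - k] with [k >= 0]. Since
    [S n >= - d n] infinitely often, the Birkhoff theorem bounds the averages of [k] by a
    multiple of [d], and the upper bound on the backward sums bounds [g o T^n] by a multiple
    of [d n].

    The Birkhoff theorem is only needed for nonnegative functions and up to constants; it
    follows from a maximal inequality for simple functions. *)

Require Import Defs.
From Stdlib Require Import Reals Lra Lia ZArith List Classical ClassicalEpsilon.
From Stdlib Require Import FunctionalExtensionality PropExtensionality.
Open Scope R_scope.

(** [M] and [mu] take predicates as arguments, so two descriptions of a set must be equal before one
    can replace the other under them. *)
Lemma pred_ext {X : Type} (A B : X -> Prop) : (forall x, A x <-> B x) -> A = B.
Proof.
  intros H. apply functional_extensionality. intros x.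
  apply propositional_extensionality. apply H.
Qed.

(** Rationals are coded by three naturals because [sigma_algebra] provides unions indexed by
    [nat]. *)
Lemma rational_between (y z : R) : y < z -> exists i j k : nat,
  y < IZR (Z.of_nat i - Z.of_nat j) / INR (S k) < z.
Proof.
  intros H.
  destruct (archimed_cor1 (z - y)) as [m [Hm Hm0]]; [lra|].
  destruct m as [|k]; [lia|].
  pose proof (lt_0_INR (S k) ltac:(lia)) as Hk.
  destruct (archimed (y * INR (S k))) as [H1 H2].
  exists (Z.to_nat (up (y * INR (S k)))), (Z.to_nat (- up (y * INR (S k)))), k.
  replace (Z.of_nat (Z.to_nat (up (y * INR (S k)))) -
           Z.of_nat (Z.to_nat (- up (y * INR (S k)))))%Z
    with (up (y * INR (S k))) by lia.
  split.
  - apply Rmult_lt_reg_r with (INR (S k)); [lra|]. field_simplify; [|lra]. lra.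
  - assert (/ INR (S k) * INR (S k) = 1) by (field; lra).
    apply Rmult_lt_reg_r with (INR (S k)); [lra|]. field_simplify; [|lra]. nra.
Qed.

(** * Properties that hold eventually or infinitely often *)

Definition eventually (P : nat -> Prop) : Prop :=
  exists N, forall n, (n >= N)%nat -> P n.

Definition frequently (P : nat -> Prop) : Prop :=
  forall N, exists n, (n >= N)%nat /\ P n.

Lemma eventually_and (P Q : nat -> Prop) :
  eventually P -> eventually Q -> eventually (fun n => P n /\ Q n).
Proof.
  intros [N1 H1] [N2 H2]. exists (N1 + N2)%nat.
  intros n Hn. split; [apply H1 | apply H2]; lia.
Qed.

Lemma eventually_mono (P Q : nat -> Prop) :
  (forall n, P n -> Q n) -> eventually P -> eventually Q.
Proof. intros H [N HN]. exists N. auto. Qed.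

Lemma eventually_INR_ge (a : R) : eventually (fun n => a <= INR n).
Proof.
  destruct (INR_unbounded a) as [N HN]. exists N. intros n Hn. apply le_INR in Hn. lra.
Qed.

Lemma eventually_nat_ge (m : nat) : eventually (fun n => (n >= m)%nat).
Proof. exists m. auto. Qed.

Lemma eventually_forall_lt (n : nat) (P : nat -> nat -> Prop) :
  (forall i, eventually (P i)) -> eventually (fun N => forall i, (i < n)%nat -> P i N).
Proof.
  intros H. induction n as [|n IH].
  - exists 0%nat. intros; lia.
  - eapply eventually_mono; [|exact (eventually_and _ _ IH (H n))].
    intros N [H1 H2] i Hi. destruct (Nat.eq_dec i n); [subst; auto | apply H1; lia].
Qed.

Lemma not_eventually (P : nat -> Prop) :
  ~ eventually P -> frequently (fun n => ~ P n).
Proof.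
  intros H N. apply NNPP. intros H1. apply H. exists N. intros n Hn.
  apply NNPP. intros H2. apply H1. exists n. auto.
Qed.

Lemma frequently_and_eventually (P Q : nat -> Prop) :
  frequently P -> eventually Q -> frequently (fun n => P n /\ Q n).
Proof.
  intros H [N HN] m. destruct (H (m + N)%nat) as [n [Hn Hp]].
  exists n. repeat split; auto; try apply HN; lia.
Qed.

Lemma inv_INR_S_pos (m : nat) : 0 < / INR (S m).
Proof. apply Rinv_0_lt_compat, lt_0_INR. lia. Qed.

Lemma inv_INR_S_lt (e : R) : 0 < e -> exists m : nat, / INR (S m) < e.
Proof.
  intros H. destruct (archimed_cor1 e H) as [[|m] [Hm Hm0]]; [lia|]. now exists m.
Qed.

(** * Finite sums and averages *)

Lemma sumn_ext (n : nat) (u v : nat -> R) :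
  (forall i, (i < n)%nat -> u i = v i) -> sumn n u = sumn n v.
Proof.
  induction n as [|n IH]; simpl; intros H; auto. rewrite IH, H by auto. reflexivity.
Qed.

Lemma sumn_le (n : nat) (u v : nat -> R) :
  (forall i, (i < n)%nat -> u i <= v i) -> sumn n u <= sumn n v.
Proof.
  induction n as [|n IH]; simpl; intros H; [lra|]. apply Rplus_le_compat; auto.
Qed.

Lemma sumn_const (n : nat) (c : R) : sumn n (fun _ => c) = INR n * c.
Proof. induction n as [|n IH]; [simpl; ring|]. rewrite S_INR. simpl. rewrite IH. ring. Qed.

Lemma sumn_plus (n : nat) (u v : nat -> R) :
  sumn n (fun i => u i + v i) = sumn n u + sumn n v.
Proof. induction n as [|n IH]; simpl; [ring|]. rewrite IH. ring. Qed.

Lemma sumn_scal (n : nat) (c : R) (u : nat -> R) : sumn n (fun i => c * u i) = c * sumn n u.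
Proof. induction n as [|n IH]; simpl; [ring|]. rewrite IH. ring. Qed.

Lemma sumn_split (n m : nat) (u : nat -> R) :
  sumn (n + m) u = sumn n u + sumn m (fun i => u (n + i)%nat).
Proof.
  induction m as [|m IH]; simpl; [rewrite Nat.add_0_r; ring|].
  rewrite Nat.add_succ_r. simpl. rewrite IH. ring.
Qed.

Lemma sumn_ge0 (n : nat) (u : nat -> R) : (forall i, 0 <= u i) -> 0 <= sumn n u.
Proof.
  intros H. rewrite <- (Rmult_0_r (INR n)), <- sumn_const. apply sumn_le. auto.
Qed.

Lemma sumn_incr (n m : nat) (u : nat -> R) :
  (forall i, 0 <= u i) -> (n <= m)%nat -> sumn n u <= sumn m u.
Proof.
  intros H Hnm. replace m with (n + (m - n))%nat by lia. rewrite sumn_split.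
  pose proof (sumn_ge0 (m - n) (fun i => u (n + i)%nat) (fun i => H _)). lra.
Qed.

Lemma sumn_shift_le (h c : nat) (u : nat -> R) : (forall i, 0 <= u i) ->
  sumn h (fun i => u (c + i)%nat) <= sumn (c + h) u.
Proof. intros H. rewrite sumn_split. pose proof (sumn_ge0 c u H). lra. Qed.

Lemma sumn_even_le (h : nat) (u : nat -> R) : (forall i, 0 <= u i) ->
  sumn h (fun i => u (2 * i)%nat) <= sumn (2 * h) u.
Proof.
  intros H. induction h as [|h IH]; [simpl; lra|].
  replace (2 * S h)%nat with (S (S (2 * h))) by lia. cbn [sumn].
  pose proof (H (S (2 * h))). lra.
Qed.

Lemma sumn_rev (n : nat) (u : nat -> R) :
  sumn n (fun i => u (n - 1 - i)%nat) = sumn n u.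
Proof.
  revert u. induction n as [|n IH]; intros u; [reflexivity|].
  change (S n) with (1 + n)%nat. rewrite (sumn_split 1 n (fun i => u (1 + n - 1 - i)%nat)).
  change (sumn (1 + n) u) with (sumn n u + u n). cbn [sumn].
  rewrite <- (IH u).
  replace (1 + n - 1 - 0)%nat with n by lia.
  rewrite (sumn_ext n (fun i => u (1 + n - 1 - (1 + i))%nat) (fun i => u (n - 1 - i)%nat)).
  - ring.
  - intros i Hi. f_equal. lia.
Qed.

(** Pigeonhole: when [u] counts bad events, a total below [n] leaves an index at which none
    occurs. *)
Lemma sumn_lt_length (n : nat) (u : nat -> R) :
  sumn n u < INR n -> exists i, (i < n)%nat /\ u i < 1.
Proof.
  intros H. apply NNPP. intros H1.
  assert (sumn n (fun _ => 1) <= sumn n u); [|rewrite sumn_const in H0; lra].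
  apply sumn_le. intros i Hi. apply Rnot_lt_le. intros H2. apply H1. now exists i.
Qed.

(* Greedy covering: chop [0, L) into consecutive blocks of length at most [N] with
   nonpositive sums; only the last, incomplete, block can contribute. *)
Lemma sumn_greedy (N : nat) (B : R) (u : nat -> R) : 0 <= B -> (forall i, u i <= B) ->
  (forall j, exists n, (1 <= n <= N)%nat /\ sumn n (fun i => u (j + i)%nat) <= 0) ->
  forall L, sumn L u <= INR N * B.
Proof.
  intros HB Hu Hcov L.
  assert (H : forall L j, sumn L (fun i => u (j + i)%nat) <= INR N * B).
  2:{ exact (H L 0%nat). }
  clear L. induction L as [L IH] using lt_wf_ind. intros j.
  destruct (Hcov j) as [n [Hn Hs]]. destruct (Nat.le_gt_cases n L) as [H|H].
  - replace L with (n + (L - n))%nat by lia. rewrite sumn_split.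
    specialize (IH (L - n)%nat ltac:(lia) (j + n)%nat).
    rewrite (sumn_ext (L - n) _ (fun i => u (j + n + i)%nat)); [lra|].
    intros i _. f_equal. lia.
  - apply Rle_trans with (sumn L (fun _ => B)); [apply sumn_le; auto|].
    rewrite sumn_const. apply Rmult_le_compat_r; auto. apply le_INR. lia.
Qed.

(** * Orbits and Birkhoff sums *)

Lemma iter_add {X : Type} (T : X -> X) (n m : nat) (x : X) :
  Nat.iter (n + m) T x = Nat.iter n T (Nat.iter m T x).
Proof. induction n as [|n IH]; simpl; auto. now rewrite IH. Qed.

Lemma iter_succ_r {X : Type} (T : X -> X) (n : nat) (x : X) :
  Nat.iter (S n) T x = Nat.iter n T (T x).
Proof. rewrite <- Nat.add_1_r. apply iter_add. Qed.

(** The Birkhoff sum. The map is a parameter so that the same lemmas serve [T] and [Tinv]. *)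
Definition bsum {X : Type} (T : X -> X) (f : X -> R) (n : nat) (x : X) : R :=
  sumn n (fun i => f (Nat.iter i T x)).

Lemma bsum_add {X : Type} (T : X -> X) (f : X -> R) (n m : nat) (x : X) :
  bsum T f (n + m) x = bsum T f n x + bsum T f m (Nat.iter n T x).
Proof.
  unfold bsum. rewrite sumn_split. f_equal. apply sumn_ext. intros i _.
  now rewrite Nat.add_comm, iter_add.
Qed.

Lemma bsum_succ {X : Type} (T : X -> X) (f : X -> R) (n : nat) (x : X) :
  bsum T f (S n) x = f x + bsum T f n (T x).
Proof. change (S n) with (1 + n)%nat. rewrite bsum_add. unfold bsum at 1. simpl. ring. Qed.

Lemma bsum_sub_const {X : Type} (T : X -> X) (f : X -> R) (c : R) (n : nat) (x : X) :
  bsum T (fun y => f y - c) n x = bsum T f n x - INR n * c.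
Proof.
  unfold bsum. rewrite (sumn_ext _ _ (fun i => f (Nat.iter i T x) + - c)) by (intros; ring).
  rewrite sumn_plus, sumn_const. ring.
Qed.

Lemma bsum_le {X : Type} (T : X -> X) (f g : X -> R) (n : nat) (x : X) :
  (forall y, f y <= g y) -> bsum T f n x <= bsum T g n x.
Proof. intros H. apply sumn_le. auto. Qed.

(** * Extended limits and linear growth *)

Lemma tends_to_ext (u v : nat -> R) (l : ExtR) :
  eventually (fun n => u n = v n) -> tends_to u l -> tends_to v l.
Proof.
  intros [N1 HN1] Hu. destruct l as [c| |]; simpl in *.
  - intros eps Heps. destruct (Hu eps Heps) as [N2 HN2]. exists (N1 + N2)%nat.
    intros n Hn. rewrite <- HN1 by lia. apply HN2. lia.
  - intros A. destruct (Hu A) as [N2 HN2]. exists (N1 + N2)%nat.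
    intros n Hn. rewrite <- HN1 by lia. apply HN2. lia.
  - intros A. destruct (Hu A) as [N2 HN2]. exists (N1 + N2)%nat.
    intros n Hn. rewrite <- HN1 by lia. apply HN2. lia.
Qed.

Definition ext_opp (l : ExtR) : ExtR :=
  match l with EFin c => EFin (- c) | EMinf => EPinf | EPinf => EMinf end.

Lemma tends_to_opp (u : nat -> R) (l : ExtR) :
  tends_to u l -> tends_to (fun n => - u n) (ext_opp l).
Proof.
  destruct l as [c| |]; simpl.
  - intros Hu. exact (CV_opp u c Hu).
  - intros Hu A. destruct (Hu (- A)) as [N HN]. exists N. intros n Hn.
    specialize (HN n Hn). lra.
  - intros Hu A. destruct (Hu (- A)) as [N HN]. exists N. intros n Hn.
    specialize (HN n Hn). lra.
Qed.

Lemma limsup_lt_pinf_of_tends (u : nat -> R) (l : ExtR) :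
  l <> EPinf -> tends_to u l -> limsup_lt_pinf u.
Proof.
  destruct l as [c| |]; simpl; intros Hl Hu; [| |tauto].
  - destruct (Hu 1 ltac:(lra)) as [N HN]. exists (c + 1), N. intros n Hn.
    specialize (HN n Hn). unfold Rdist in HN. apply Rabs_def2 in HN. lra.
  - exists 0. apply Hu.
Qed.

(** Means [u n = c n + o(n)], or [u n / n] tending to minus infinity. Without quotients, bounds for
    forward and backward sums can simply be added. *)
Definition linear_growth (u : nat -> R) (l : ExtR) : Prop :=
  match l with
  | EFin c => forall e, 0 < e -> eventually (fun n => Rabs (u n - c * INR n) <= e * INR n)
  | EMinf => forall a, eventually (fun n => u n <= a * INR n)
  | EPinf => False
  end.

Lemma average_close (L s c e : R) :
  0 < L -> Rabs (s - c * L) <= e * L -> Rabs (/ L * s - c) <= e.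
Proof.
  intros HL H. replace (/ L * s - c) with (/ L * (s - c * L)) by (field; lra).
  rewrite Rabs_mult, (Rabs_pos_eq (/ L)) by (apply Rlt_le, Rinv_0_lt_compat; auto).
  apply Rmult_le_reg_l with L; auto. rewrite <- Rmult_assoc, Rinv_r by lra. lra.
Qed.

Lemma average_le (L s a : R) : 0 < L -> s <= a * L -> / L * s <= a.
Proof.
  intros HL H. apply Rmult_le_reg_l with L; auto. rewrite <- Rmult_assoc, Rinv_r by lra. lra.
Qed.

Lemma growth_average (u : nat -> R) (l : ExtR) :
  linear_growth u l -> tends_to (fun n => / INR n * u n) l.
Proof.
  destruct l as [c| |]; cbn [tends_to linear_growth]; [| |tauto].
  - intros Hu eps Heps. destruct (Hu (eps / 2) ltac:(lra)) as [N HN]. exists (N + 1)%nat.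
    intros n Hn. unfold Rdist. apply Rle_lt_trans with (eps / 2); [|lra].
    apply average_close; [apply lt_0_INR; lia|]. apply HN. lia.
  - intros Hu A. destruct (Hu A) as [N HN]. exists (N + 1)%nat. intros n Hn.
    apply average_le; [apply lt_0_INR; lia|]. apply HN. lia.
Qed.

(** A bilateral sum is a backward sum of length [S n] plus a forward sum of length [n + p]; the
    central value [r] lies in both and is subtracted once. The two lengths add up to one more than
    the window length [2 n + p]. *)
Lemma growth_bilateral (u v : nat -> R) (r : R) (p : Z) (l : ExtR) :
  linear_growth u l -> linear_growth v l ->
  tends_to (fun n => / IZR (2 * Z.of_nat n + p) *
    (v (S n) - r + u (Z.to_nat (Z.of_nat n + p)))) l.
Proof.
  assert (HL : forall n, (n >= Z.abs_nat p + 1)%nat ->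
    0 < IZR (2 * Z.of_nat n + p) /\ INR n <= IZR (2 * Z.of_nat n + p)).
  { intros n Hn. split; [apply IZR_lt; lia|]. rewrite INR_IZR_INZ. apply IZR_le. lia. }
  assert (Heq : forall n, (n >= Z.abs_nat p + 1)%nat ->
    INR (S n) + INR (Z.to_nat (Z.of_nat n + p)) = IZR (2 * Z.of_nat n + p) + 1).
  { intros n Hn. rewrite !INR_IZR_INZ, <- !plus_IZR. f_equal. lia. }
  destruct l as [c| |]; cbn [tends_to linear_growth]; [| |tauto].
  - intros Hu Hv eps Heps. set (e := eps / 4). assert (He : 0 < e) by (unfold e; lra).
    destruct (Hu e He) as [N1 HN1]. destruct (Hv e He) as [N2 HN2].
    (* Beyond [N3], the term [e * L] absorbs the surplus index and the central value, which together
       cost [e + Rabs (c - r)]. *)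
    destruct (eventually_INR_ge ((e + Rabs (c - r)) / e)) as [N3 HN3].
    exists (N1 + N2 + N3 + Z.abs_nat p + 1)%nat. intros n Hn. unfold Rdist.
    apply Rle_lt_trans with (2 * e); [|unfold e; lra].
    destruct (HL n ltac:(lia)) as [HL1 HL2]. apply average_close; auto.
    specialize (HN1 (Z.to_nat (Z.of_nat n + p)) ltac:(lia)).
    specialize (HN2 (S n) ltac:(lia)). specialize (HN3 n ltac:(lia)).
    specialize (Heq n ltac:(lia)).
    set (L := IZR (2 * Z.of_nat n + p)) in *.
    set (n1 := Z.to_nat (Z.of_nat n + p)) in *.
    assert (H3 : e + Rabs (c - r) <= e * L).
    { apply Rle_trans with ((e + Rabs (c - r)) / e * e); [apply Req_le; field; lra|].
      rewrite Rmult_comm. apply Rmult_le_compat_l; lra. }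
    replace (v (S n) - r + u n1 - c * L)
      with ((v (S n) - c * INR (S n)) + ((u n1 - c * INR n1) + (c - r)))
      by (replace L with (INR (S n) + INR n1 - 1) by lra; ring).
    eapply Rle_trans; [apply Rabs_triang|].
    eapply Rle_trans; [apply Rplus_le_compat_l, Rabs_triang|].
    assert (e * INR (S n) + e * INR n1 = e * L + e)
      by (rewrite <- Rmult_plus_distr_l, Heq; ring).
    lra.
  - intros Hu Hv A.
    (* The slope [A - 1] leaves a margin equal to the window length, which eventually absorbs the
       constant [A - 1 - r]. *)
    destruct (Hu (A - 1)) as [N1 HN1]. destruct (Hv (A - 1)) as [N2 HN2].
    destruct (eventually_INR_ge (A - 1 - r)) as [N3 HN3].
    exists (N1 + N2 + N3 + Z.abs_nat p + 1)%nat. intros n Hn.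
    destruct (HL n ltac:(lia)) as [HL1 HL2]. apply average_le; auto.
    specialize (HN1 (Z.to_nat (Z.of_nat n + p)) ltac:(lia)).
    specialize (HN2 (S n) ltac:(lia)). specialize (HN3 n ltac:(lia)).
    specialize (Heq n ltac:(lia)).
    assert ((A - 1) * INR (S n) + (A - 1) * INR (Z.to_nat (Z.of_nat n + p)) =
      (A - 1) * (IZR (2 * Z.of_nat n + p) + 1))
      by (rewrite <- Rmult_plus_distr_l, Heq; ring).
    lra.
Qed.

(** * Measures and integration of simple functions *)

Section MeasureSpace.
Context {X : Type} (M : (X -> Prop) -> Prop) (mu : (X -> Prop) -> R).
Context (HM : sigma_algebra M) (Hmu : probability_measure M mu).

Lemma meas_not (A : X -> Prop) : M A -> M (fun x => ~ A x).
Proof. apply HM. Qed.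

Lemma meas_ex (A : nat -> X -> Prop) : (forall n, M (A n)) -> M (fun x => exists n, A n x).
Proof. apply HM. Qed.

Lemma meas_all (A : nat -> X -> Prop) : (forall n, M (A n)) -> M (fun x => forall n, A n x).
Proof.
  intros H.
  replace (fun x => forall n, A n x) with (fun x => ~ exists n, ~ A n x).
  - apply meas_not, meas_ex. intros n. now apply meas_not.
  - apply pred_ext. intros x. split; [|firstorder].
    intros H1 n. apply NNPP. intros H2. apply H1. now exists n.
Qed.

Lemma meas_const (P : Prop) : M (fun _ => P).
Proof.
  destruct (classic P) as [H|H].
  - replace (fun _ : X => P) with (fun _ : X => True) by (apply pred_ext; tauto). apply HM.
  - replace (fun _ : X => P) with (fun _ : X => ~ True) by (apply pred_ext; tauto).
    apply meas_not. apply HM.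
Qed.

Lemma meas_or (A B : X -> Prop) : M A -> M B -> M (fun x => A x \/ B x).
Proof.
  intros HA HB.
  replace (fun x => A x \/ B x)
    with (fun x => exists n : nat, (match n with O => A | _ => B end) x).
  - apply meas_ex. now intros [|n].
  - apply pred_ext. intros x. split.
    + intros [[|n] H]; tauto.
    + intros [H|H]; [exists 0%nat | exists 1%nat]; auto.
Qed.

Lemma meas_and (A B : X -> Prop) : M A -> M B -> M (fun x => A x /\ B x).
Proof.
  intros HA HB.
  replace (fun x => A x /\ B x) with (fun x => ~ (~ A x \/ ~ B x))
    by (apply pred_ext; intros; tauto).
  apply meas_not, meas_or; now apply meas_not.
Qed.

Lemma meas_imp (A B : X -> Prop) : M A -> M B -> M (fun x => A x -> B x).
Proof.
  intros HA HB.
  replace (fun x => A x -> B x) with (fun x => ~ A x \/ B x)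
    by (apply pred_ext; intros; tauto).
  apply meas_or; auto. now apply meas_not.
Qed.

(** * Measurable functions *)

Lemma mfun_const (a : R) : measurable_fun M (fun _ => a).
Proof. intros b. apply meas_const. Qed.

Lemma mfun_add (f g : X -> R) :
  measurable_fun M f -> measurable_fun M g -> measurable_fun M (fun x => f x + g x).
Proof.
  intros Hf Hg a.
  replace (fun x => f x + g x < a)
    with (fun x => exists i j k : nat,
      f x < IZR (Z.of_nat i - Z.of_nat j) / INR (S k) /\
      g x < a - IZR (Z.of_nat i - Z.of_nat j) / INR (S k)).
  - apply meas_ex; intros i. apply meas_ex; intros j. apply meas_ex; intros k.
    now apply meas_and.
  - apply pred_ext. intros x. split.
    + intros (i & j & k & H1 & H2). lra.
    + intros H. destruct (rational_between (f x) (a - g x)) as (i & j & k & H1); [lra|].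
      exists i, j, k. lra.
Qed.

Lemma meas_le_const (f : X -> R) (a : R) : measurable_fun M f -> M (fun x => f x <= a).
Proof.
  intros Hf.
  replace (fun x => f x <= a) with (fun x => forall m : nat, f x < a + / INR (S m)).
  - apply meas_all. intros m. apply Hf.
  - apply pred_ext. intros x. split.
    + intros H. apply Rnot_lt_le. intros H1.
      destruct (inv_INR_S_lt (f x - a)) as [m Hm]; [lra|]. specialize (H m). lra.
    + intros H m. pose proof (inv_INR_S_pos m). lra.
Qed.

Lemma mfun_opp (f : X -> R) : measurable_fun M f -> measurable_fun M (fun x => - f x).
Proof.
  intros Hf a.
  replace (fun x => - f x < a) with (fun x => ~ f x <= - a)
    by (apply pred_ext; intros x; lra).
  now apply meas_not, meas_le_const.
Qed.

Lemma mfun_sub (f g : X -> R) :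
  measurable_fun M f -> measurable_fun M g -> measurable_fun M (fun x => f x - g x).
Proof. intros Hf Hg. apply mfun_add; auto. now apply mfun_opp. Qed.

Lemma mfun_scal (c : R) (f : X -> R) :
  measurable_fun M f -> measurable_fun M (fun x => c * f x).
Proof.
  intros Hf.
  assert (Hpos : forall d, 0 < d -> measurable_fun M (fun x => d * f x)).
  { intros d Hd a.
    replace (fun x => d * f x < a) with (fun x => f x < a / d); [apply Hf|].
    apply pred_ext. intros x. assert (a / d * d = a) by (field; lra). split; intros; nra. }
  destruct (Rtotal_order c 0) as [H|[H|H]].
  - replace (fun x => c * f x) with (fun x => - (- c * f x))
      by (apply functional_extensionality; intros; ring).
    apply mfun_opp, Hpos. lra.
  - subst. replace (fun x => 0 * f x) with (fun _ : X => 0)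
      by (apply functional_extensionality; intros; ring).
    apply mfun_const.
  - now apply Hpos.
Qed.

Lemma mfun_max (f g : X -> R) :
  measurable_fun M f -> measurable_fun M g -> measurable_fun M (fun x => Rmax (f x) (g x)).
Proof.
  intros Hf Hg a.
  replace (fun x => Rmax (f x) (g x) < a) with (fun x => f x < a /\ g x < a).
  - now apply meas_and.
  - apply pred_ext. intros x. unfold Rmax. destruct (Rle_dec (f x) (g x)); lra.
Qed.

Lemma meas_le (f g : X -> R) :
  measurable_fun M f -> measurable_fun M g -> M (fun x => f x <= g x).
Proof.
  intros Hf Hg.
  replace (fun x => f x <= g x) with (fun x => f x - g x <= 0)
    by (apply pred_ext; intros; lra).
  now apply meas_le_const, mfun_sub.
Qed.

Lemma meas_lt (f g : X -> R) :
  measurable_fun M f -> measurable_fun M g -> M (fun x => f x < g x).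
Proof.
  intros Hf Hg.
  replace (fun x => f x < g x) with (fun x => ~ g x <= f x)
    by (apply pred_ext; intros; lra).
  now apply meas_not, meas_le.
Qed.

Lemma mfun_sumn (n : nat) (g : nat -> X -> R) :
  (forall i, measurable_fun M (g i)) -> measurable_fun M (fun x => sumn n (fun i => g i x)).
Proof.
  intros H. induction n as [|n IH]; simpl.
  - apply mfun_const.
  - now apply mfun_add.
Qed.

Lemma meas_eventually (P : nat -> X -> Prop) :
  (forall n, M (P n)) -> M (fun x => eventually (fun n => P n x)).
Proof.
  intros H. apply meas_ex; intros N. apply meas_all; intros n.
  apply meas_imp; auto. apply meas_const.
Qed.

Lemma meas_frequently (P : nat -> X -> Prop) :
  (forall n, M (P n)) -> M (fun x => frequently (fun n => P n x)).
Proof.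
  intros H. apply meas_all; intros N. apply meas_ex; intros n.
  apply meas_and; auto. apply meas_const.
Qed.

(** * Elementary properties of the measure *)

Lemma mu_ge0 (A : X -> Prop) : M A -> 0 <= mu A.
Proof. apply Hmu. Qed.

Lemma mu_full : mu (fun _ => True) = 1.
Proof. apply Hmu. Qed.

(** Countable additivity for a sequence of empty sets: if their measure [e] were positive, the
    growing multiples of [e] could not converge to [e]. *)
Lemma mu_empty : mu (fun _ => False) = 0.
Proof.
  destruct Hmu as [Hpos [Hfull Hadd]].
  specialize (Hadd (fun _ _ => False) (fun _ => meas_const False) ltac:(tauto)).
  cbv beta in Hadd.
  replace (fun _ : X => exists _ : nat, False) with (fun _ : X => False) in Hadd
    by (apply pred_ext; firstorder).
  set (e := mu (fun _ => False)) in *.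
  assert (He : 0 <= e) by (apply Hpos, meas_const).
  destruct (Rle_lt_or_eq_dec 0 e He) as [H|H]; auto.
  destruct (Hadd e H) as [N HN]. specialize (HN (S N) ltac:(lia)).
  unfold Rdist in HN. rewrite sum_cte in HN. rewrite !S_INR in HN.
  pose proof (pos_INR N).
  replace (e * (INR N + 1 + 1) - e) with (e * (INR N + 1)) in HN by ring.
  assert (0 <= e * INR N) by (apply Rmult_le_pos; lra).
  rewrite Rabs_pos_eq in HN; lra.
Qed.

Lemma mu_union (A B : X -> Prop) :
  M A -> M B -> (forall x, A x -> B x -> False) -> mu (fun x => A x \/ B x) = mu A + mu B.
Proof.
  intros HA HB Hd.
  set (D := fun n : nat => match n with O => A | S O => B | _ => fun _ => False end).
  assert (HD : forall n, M (D n)) by (intros [|[|n]]; simpl; auto; apply meas_const).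
  assert (Hdis : forall n m x, n <> m -> D n x -> D m x -> False).
  { intros [|[|n]] [|[|m]] x Hn; simpl; try tauto; try lia; eauto. }
  pose proof (proj2 (proj2 Hmu) D HD Hdis) as Hs.
  replace (fun x => exists n, D n x) with (fun x => A x \/ B x) in Hs.
  2:{ apply pred_ext. intros x. split.
      - intros [H|H]; [exists 0%nat | exists 1%nat]; auto.
      - intros [[|[|n]] H]; simpl in H; tauto. }
  apply (uniqueness_sum _ _ _ Hs).
  intros eps Heps. exists 1%nat. intros n Hn.
  replace (sum_f_R0 (fun n => mu (D n)) n) with (mu A + mu B).
  - unfold Rdist. rewrite Rminus_diag, Rabs_R0. lra.
  - induction n as [|[|n] IH]; [lia| reflexivity |].
    rewrite tech5, <- IH by lia. simpl. rewrite mu_empty. ring.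
Qed.

Lemma mu_split (A B : X -> Prop) :
  M A -> M B -> mu A = mu (fun x => A x /\ B x) + mu (fun x => A x /\ ~ B x).
Proof.
  intros HA HB. rewrite <- mu_union.
  - f_equal. apply pred_ext. intros x. tauto.
  - now apply meas_and.
  - apply meas_and; auto. now apply meas_not.
  - tauto.
Qed.

Lemma mu_mono (A B : X -> Prop) :
  M A -> M B -> (forall x, A x -> B x) -> mu A <= mu B.
Proof.
  intros HA HB H. rewrite (mu_split B A) by auto.
  replace (fun x => B x /\ A x) with A by (apply pred_ext; firstorder).
  assert (0 <= mu (fun x => B x /\ ~ A x)); [|lra].
  apply mu_ge0, meas_and; auto. now apply meas_not.
Qed.

Lemma mu_not (A : X -> Prop) : M A -> mu (fun x => ~ A x) = 1 - mu A.
Proof.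
  intros HA. pose proof (mu_split (fun _ => True) A (meas_const True) HA) as H.
  rewrite mu_full in H.
  replace (fun x => True /\ A x) with A in H by (apply pred_ext; tauto).
  replace (fun x => True /\ ~ A x) with (fun x => ~ A x) in H by (apply pred_ext; tauto).
  lra.
Qed.

Lemma mu_le1 (A : X -> Prop) : M A -> mu A <= 1.
Proof. intros HA. rewrite <- mu_full. apply mu_mono; auto. apply meas_const. Qed.

Lemma mu_union_le (A B : X -> Prop) :
  M A -> M B -> mu (fun x => A x \/ B x) <= mu A + mu B.
Proof.
  intros HA HB. rewrite (mu_split (fun x => A x \/ B x) A) by auto using meas_or.
  replace (fun x => (A x \/ B x) /\ A x) with A by (apply pred_ext; tauto).
  apply Rplus_le_compat_l, mu_mono; auto; [|tauto].
  apply meas_and; [now apply meas_or | now apply meas_not].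
Qed.

(** The successive differences [D n] are disjoint with the same union, and their measures add up to
    [mu (A n)]. *)
Lemma mu_continuous_below (A : nat -> X -> Prop) :
  (forall n, M (A n)) -> (forall n x, A n x -> A (S n) x) ->
  Un_cv (fun n => mu (A n)) (mu (fun x => exists n, A n x)).
Proof.
  intros HA Hinc.
  assert (Hle : forall n m x, (n <= m)%nat -> A n x -> A m x).
  { intros n m x Hnm. induction Hnm; auto. }
  set (D := fun n : nat => match n with O => A O | S m => fun x => A (S m) x /\ ~ A m x end).
  assert (HD : forall n, M (D n)).
  { intros [|n]; simpl; auto. apply meas_and; auto. now apply meas_not. }
  assert (HDA : forall n x, D n x -> A n x) by (intros [|n] x; simpl; tauto).
  assert (Hlt : forall n m x, (n < m)%nat -> D n x -> D m x -> False).
  { intros n [|m] x Hn H1 H2; [lia|]. destruct H2 as [_ H2]. apply H2.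
    apply (Hle n); [lia | auto]. }
  assert (Hdis : forall n m x, n <> m -> D n x -> D m x -> False).
  { intros n m x Hn H1 H2. destruct (Nat.lt_total n m) as [H|[H|H]]; eauto. }
  pose proof (proj2 (proj2 Hmu) D HD Hdis) as Hs.
  replace (fun x => exists n, D n x) with (fun x => exists n, A n x) in Hs.
  2:{ apply pred_ext. intros x. split.
      - intros [n H]. induction n as [|n IH]; [now exists 0%nat|].
        destruct (classic (A n x)); auto. exists (S n). now split.
      - intros [n H]. exists n. auto. }
  intros eps Heps. destruct (Hs eps Heps) as [N HN]. exists N. intros n Hn.
  replace (mu (A n)) with (sum_f_R0 (fun n => mu (D n)) n); [now apply HN|].
  clear Hn. induction n as [|n IH]; [reflexivity|].
  rewrite tech5, IH, (mu_split (A (S n)) (A n)) by auto. simpl.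
  f_equal. f_equal. apply pred_ext. split; [split|]; try tauto. now apply Hinc.
Qed.

Lemma mu_below_gt (A : nat -> X -> Prop) (a : R) :
  (forall n, M (A n)) -> (forall n x, A n x -> A (S n) x) ->
  a < mu (fun x => exists n, A n x) -> eventually (fun n => a < mu (A n)).
Proof.
  intros HA Hinc Ha.
  destruct (mu_continuous_below A HA Hinc (mu (fun x => exists n, A n x) - a)) as [N HN];
    [lra|].
  exists N. intros n Hn. specialize (HN n Hn). unfold Rdist in HN.
  apply Rabs_def2 in HN. lra.
Qed.

Lemma mu_null_union (A : nat -> X -> Prop) :
  (forall n, M (A n)) -> (forall n, mu (A n) = 0) -> mu (fun x => exists n, A n x) = 0.
Proof.
  intros HA H0.
  (* [B n] is the union of [A 0, ..., A n]: it increases with [n] and stays null by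
     subadditivity. *)
  set (B := fun n => nat_rect (fun _ => X -> Prop) (A O) (fun m P x => P x \/ A (S m) x) n).
  assert (HB : forall n, M (B n)).
  { induction n as [|n IH]; simpl; auto. now apply meas_or. }
  assert (HB0 : forall n, mu (B n) <= 0).
  { induction n as [|n IH]; simpl; [rewrite H0; lra|].
    pose proof (mu_union_le (B n) (A (S n)) (HB n) (HA _)) as H. rewrite H0 in H.
    unfold B in *. lra. }
  assert (HAB : forall n x, A n x -> B n x) by (intros [|n]; simpl; auto).
  assert (Hn : 0 <= mu (fun x => exists n, A n x)) by now apply mu_ge0, meas_ex.
  destruct (Rle_lt_or_eq_dec _ _ Hn) as [H|H]; auto. exfalso.
  destruct (mu_below_gt B 0) as [N HN]; auto.
  - intros n x H1. now left.
  - apply Rlt_le_trans with (1 := H). apply mu_mono; try (apply meas_ex; auto).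
    intros x [n H1]. exists n. auto.
  - specialize (HN N ltac:(lia)). specialize (HB0 N). lra.
Qed.

(** * Almost everywhere statements *)

Lemma ae_all (P : nat -> X -> Prop) :
  (forall n, ae M mu (P n)) -> ae M mu (fun x => forall n, P n x).
Proof.
  intros H. apply choice in H. destruct H as [N HN].
  exists (fun x => exists n, N n x). split; [apply meas_ex; apply HN|].
  split; [apply mu_null_union; apply HN|].
  intros x Hx n. apply HN. intros H. apply Hx. now exists n.
Qed.

Lemma ae_mono (P Q : X -> Prop) : (forall x, P x -> Q x) -> ae M mu P -> ae M mu Q.
Proof. intros H [N [H1 [H2 H3]]]. exists N. auto. Qed.

Lemma ae_and (P Q : X -> Prop) : ae M mu P -> ae M mu Q -> ae M mu (fun x => P x /\ Q x).
Proof.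
  intros HP HQ.
  apply ae_mono with (fun x => forall n : nat, (match n with O => P | _ => Q end) x).
  - intros x H. split; [apply (H 0%nat) | apply (H 1%nat)].
  - apply ae_all. now intros [|n].
Qed.

Lemma ae_of_mu1 (A : X -> Prop) : M A -> mu A = 1 -> ae M mu A.
Proof.
  intros HA H. exists (fun x => ~ A x). split; [now apply meas_not|].
  split; [rewrite mu_not; auto; lra|]. intros x. apply NNPP.
Qed.

Lemma mu1_of_ae (A : X -> Prop) : M A -> ae M mu A -> mu A = 1.
Proof.
  intros HA [N [H1 [H2 H3]]].
  assert (mu (fun x => ~ A x) <= mu N).
  { apply mu_mono; auto. now apply meas_not. intros x Hx. apply NNPP. auto. }
  rewrite mu_not, H2 in H; auto. pose proof (mu_le1 A HA). lra.
Qed.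

(** Monotonicity in [e] reduces the uncountable conjunction to the values [/ INR (S m)]. *)
Lemma ae_all_eps (P : R -> X -> Prop) :
  (forall e e' x, e <= e' -> P e x -> P e' x) ->
  (forall e, 0 < e -> ae M mu (P e)) -> ae M mu (fun x => forall e, 0 < e -> P e x).
Proof.
  intros Hmono H.
  apply ae_mono with (fun x => forall m : nat, P (/ INR (S m)) x).
  - intros x Hx e He. destruct (inv_INR_S_lt e He) as [m Hm].
    apply Hmono with (/ INR (S m)); auto. lra.
  - apply ae_all. intros m. apply H, inv_INR_S_pos.
Qed.

(** * Indicators, simple functions and their integrals *)

Definition ind (A : X -> Prop) (x : X) : R := if excluded_middle_informative (A x) then 1 else 0.

Lemma ind_true (A : X -> Prop) (x : X) : A x -> ind A x = 1.
Proof. intros H. unfold ind. destruct excluded_middle_informative; tauto. Qed.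

Lemma ind_false (A : X -> Prop) (x : X) : ~ A x -> ind A x = 0.
Proof. intros H. unfold ind. destruct excluded_middle_informative; tauto. Qed.

Lemma ind_bounds (A : X -> Prop) (x : X) : 0 <= ind A x <= 1.
Proof. unfold ind. destruct excluded_middle_informative; lra. Qed.

Lemma ind_lt1 (A : X -> Prop) (x : X) : ind (fun y => ~ A y) x < 1 -> A x.
Proof. intros H. apply NNPP. intros H1. rewrite ind_true in H; auto. lra. Qed.

Lemma mfun_ind (A : X -> Prop) : M A -> measurable_fun M (ind A).
Proof.
  intros HA a.
  replace (fun x => ind A x < a) with (fun x => (A x /\ 1 < a) \/ (~ A x /\ 0 < a)).
  - apply meas_or; apply meas_and; auto using meas_const, meas_not.
  - apply pred_ext. intros x. destruct (classic (A x)) as [H|H].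
    + rewrite ind_true; tauto.
    + rewrite ind_false; tauto.
Qed.

(* A list [(w_1, A_1); ...; (w_r, A_r)] stands for the simple function
   [w_1 1_{A_1} + ... + w_r 1_{A_r}]; the sets may overlap. *)
Definition simple : Type := list (R * (X -> Prop)).

Definition seval (s : simple) (x : X) : R :=
  fold_right (fun p r => fst p * ind (snd p) x + r) 0 s.

Definition sint (s : simple) : R := fold_right (fun p r => fst p * mu (snd p) + r) 0 s.

Definition smeas (s : simple) : Prop := Forall (fun p => M (snd p)) s.

Lemma seval_app (s t : simple) (x : X) : seval (s ++ t) x = seval s x + seval t x.
Proof. induction s as [|p s IH]; simpl; [ring|]. rewrite IH. ring. Qed.

Lemma sint_app (s t : simple) : sint (s ++ t) = sint s + sint t.
Proof. induction s as [|p s IH]; simpl; [ring|]. rewrite IH. ring. Qed.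

Definition sopp (s : simple) : simple := map (fun p => (- fst p, snd p)) s.

Lemma seval_sopp (s : simple) (x : X) : seval (sopp s) x = - seval s x.
Proof. induction s as [|p s IH]; simpl; [ring|]. rewrite IH. ring. Qed.

Lemma sint_sopp (s : simple) : sint (sopp s) = - sint s.
Proof. induction s as [|p s IH]; simpl; [ring|]. rewrite IH. ring. Qed.

Lemma smeas_sopp (s : simple) : smeas s -> smeas (sopp s).
Proof. intros H. induction H; simpl; constructor; auto. Qed.

Lemma smeas_app (s t : simple) : smeas s -> smeas t -> smeas (s ++ t).
Proof. intros Hs Ht. apply Forall_app. now split. Qed.

Lemma mfun_seval (s : simple) : smeas s -> measurable_fun M (seval s).
Proof.
  intros H. induction H as [|p s Hp Hs IH]; simpl.
  - apply mfun_const.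
  - apply mfun_add; auto. apply mfun_scal. now apply mfun_ind.
Qed.

Lemma seval_bounded (s : simple) : exists B, 0 <= B /\ forall x, Rabs (seval s x) <= B.
Proof.
  induction s as [|p s [B [HB IH]]]; simpl.
  - exists 0. split; [lra|]. intros _. rewrite Rabs_R0. lra.
  - exists (Rabs (fst p) + B). pose proof (Rabs_pos (fst p)) as Hp. split; [lra|].
    intros x. pose proof (ind_bounds (snd p) x) as Hi.
    eapply Rle_trans; [apply Rabs_triang|]. apply Rplus_le_compat; auto.
    rewrite Rabs_mult, (Rabs_pos_eq (ind _ _)) by lra. nra.
Qed.

Definition sint_on (s : simple) (B : X -> Prop) : R :=
  fold_right (fun p r => fst p * mu (fun x => B x /\ snd p x) + r) 0 s.

Lemma sint_on_split (s : simple) (A B : X -> Prop) : smeas s -> M A -> M B ->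
  sint_on s B = sint_on s (fun x => B x /\ A x) + sint_on s (fun x => B x /\ ~ A x).
Proof.
  intros Hs HA HB. induction Hs as [|p s Hp Hs IH]; simpl; [ring|].
  rewrite IH, (mu_split (fun x => B x /\ snd p x) A) by auto using meas_and.
  replace (fun x => (B x /\ snd p x) /\ A x) with (fun x => (B x /\ A x) /\ snd p x)
    by (apply pred_ext; tauto).
  replace (fun x => (B x /\ snd p x) /\ ~ A x) with (fun x => (B x /\ ~ A x) /\ snd p x)
    by (apply pred_ext; tauto).
  ring.
Qed.

(* The additive constant [c] and the set [B] absorb the head of the list:
   on [A_1] the value of [1_{A_1}] is frozen to [1], off [A_1] to [0]. *)
Lemma sint_on_ge0 (s : simple) (c : R) (B : X -> Prop) : smeas s -> M B ->
  (forall x, B x -> 0 <= c + seval s x) -> 0 <= c * mu B + sint_on s B.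
Proof.
  intros Hs. revert c B. induction Hs as [|[w A] s HA Hs IH]; simpl; intros c B HB H.
  - destruct (classic (exists x, B x)) as [[x Hx]|Hx].
    + specialize (H x Hx). pose proof (mu_ge0 B HB). nra.
    + replace B with (fun _ : X => False) by (apply pred_ext; firstorder).
      rewrite mu_empty. lra.
  - simpl in HA.
    assert (H1 : 0 <= (c + w) * mu (fun x => B x /\ A x) + sint_on s (fun x => B x /\ A x)).
    { apply IH; [now apply meas_and|]. intros x [Hx Ha]. specialize (H x Hx).
      rewrite ind_true in H by auto. lra. }
    assert (H2 : 0 <= c * mu (fun x => B x /\ ~ A x) + sint_on s (fun x => B x /\ ~ A x)).
    { apply IH; [auto using meas_and, meas_not|]. intros x [Hx Ha]. specialize (H x Hx).
      rewrite ind_false in H by auto. lra. }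
    rewrite (sint_on_split s A B), (mu_split B A) by auto. lra.
Qed.

(** Positivity is applied to the difference of [t] and [s]. In particular [sint] depends only on the
    function, although one function has many lists. *)
Lemma sint_mono (s t : simple) : smeas s -> smeas t ->
  (forall x, seval s x <= seval t x) -> sint s <= sint t.
Proof.
  intros Hs Ht H.
  assert (Hon : forall u, sint_on u (fun _ => True) = sint u).
  { induction u as [|p u IH]; simpl; auto. rewrite IH. do 3 f_equal.
    apply pred_ext. tauto. }
  pose proof (sint_on_ge0 (t ++ sopp s) 0 (fun _ => True)) as H1.
  rewrite Hon, sint_app, sint_sopp in H1.
  assert (0 <= 0 * mu (fun _ => True) + (sint t + - sint s)); [|lra].
  apply H1.
  - apply smeas_app; auto. now apply smeas_sopp.
  - apply meas_const.
  - intros x _. rewrite seval_app, seval_sopp. specialize (H x). lra.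
Qed.

(** For nonnegative [k] this bounds the Lebesgue integral, as the supremum of the integrals of
    simple functions below [k], without defining the integral itself. *)
Definition int_le (k : X -> R) (c : R) : Prop :=
  forall s, smeas s -> (forall x, seval s x <= k x) -> sint s <= c.

Lemma int_le_ind (A : X -> Prop) : M A -> int_le (ind A) (mu A).
Proof.
  intros HA s Hs H.
  replace (mu A) with (sint ((1, A) :: nil)) by (simpl; ring).
  apply sint_mono; auto.
  - repeat constructor. auto.
  - intros x. simpl. rewrite Rplus_0_r, Rmult_1_l. auto.
Qed.

Lemma int_le_ge0 (k : X -> R) (c : R) : (forall x, 0 <= k x) -> int_le k c -> 0 <= c.
Proof. intros Hk H. apply (H nil); [constructor|]. simpl. auto. Qed.

(** A layer-cake sum: [d] times the number of [j] in [1..n] with [j d < k x]. Where [k x > 0] its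
    value is the largest multiple of [d] below [k x], capped at [n d]. *)
Fixpoint staircase (k : X -> R) (d : R) (n : nat) : simple :=
  match n with
  | O => nil
  | S m => (d, fun x => INR (S m) * d < k x) :: staircase k d m
  end.

Lemma smeas_staircase (k : X -> R) (d : R) (n : nat) :
  measurable_fun M k -> smeas (staircase k d n).
Proof.
  intros Hk. induction n as [|n IH]; simpl; constructor; auto.
  apply meas_lt; auto. apply mfun_const.
Qed.

Lemma staircase_approx (k : X -> R) (d : R) (n : nat) (x : X) : 0 < d -> 0 <= k x ->
  0 <= seval (staircase k d n) x <= k x /\
  (k x <= INR n * d -> k x <= seval (staircase k d n) x + d).
Proof.
  intros Hd Hk.
  (* Above the top level the value is exactly [n d]; the induction needs this for the points that
     lie between [n d] and the next level. *)
  assert (H : (INR n * d < k x -> seval (staircase k d n) x = INR n * d) /\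
    (k x <= INR n * d ->
     0 <= seval (staircase k d n) x <= k x /\ k x <= seval (staircase k d n) x + d)).
  { induction n as [|n [IH1 IH2]].
    - simpl. split; [intros; ring|]. lra.
    - cbn [staircase seval fold_right fst snd].
      fold (seval (staircase k d n) x). rewrite S_INR in *.
      pose proof (Rmult_le_pos _ _ (pos_INR n) (Rlt_le _ _ Hd)) as Hn.
      split; intros H.
      + rewrite ind_true by auto. rewrite IH1 by lra. ring.
      + rewrite ind_false by lra. destruct (Rlt_le_dec (INR n * d) (k x)) as [H1|H1].
        * rewrite IH1 by auto. lra.
        * specialize (IH2 H1). lra. }
  destruct H as [H1 H2]. destruct (Rlt_le_dec (INR n * d) (k x)) as [H|H].
  - rewrite H1 by auto. pose proof (Rmult_le_pos _ _ (pos_INR n) (Rlt_le _ _ Hd)). lra.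
  - specialize (H2 H). lra.
Qed.

Lemma staircase_incr (k : X -> R) (d : R) (n : nat) (x : X) : 0 < d ->
  seval (staircase k d n) x <= seval (staircase k d (S n)) x.
Proof.
  intros Hd. cbn [staircase seval fold_right fst snd]. fold (seval (staircase k d n) x).
  pose proof (ind_bounds (fun x => INR (S n) * d < k x) x). nra.
Qed.

Lemma meas_iter (S : X -> X) (n : nat) (A : X -> Prop) :
  measurable_map M S -> M A -> M (fun x => A (Nat.iter n S x)).
Proof.
  intros HS HA. induction n as [|n IH]; auto.
  replace (fun x => A (Nat.iter (Datatypes.S n) S x)) with (fun x => A (Nat.iter n S (S x))).
  - exact (HS _ IH).
  - apply pred_ext. intros x. now rewrite iter_succ_r.
Qed.

Lemma mfun_iter (S : X -> X) (n : nat) (f : X -> R) :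
  measurable_map M S -> measurable_fun M f -> measurable_fun M (fun x => f (Nat.iter n S x)).
Proof. intros HS Hf a. exact (meas_iter S n _ HS (Hf a)). Qed.

Lemma mfun_bsum (S : X -> X) (f : X -> R) (n : nat) :
  measurable_map M S -> measurable_fun M f -> measurable_fun M (bsum S f n).
Proof.
  intros HS Hf. apply (mfun_sumn n (fun i x => f (Nat.iter i S x))).
  intros i. now apply mfun_iter.
Qed.

(** * Ergodic averages of nonnegative functions *)

Section Dynamics.
Context (T Tinv : X -> X) (HT : invertible_mpt M mu T Tinv) (Herg : ergodic M mu T).

Lemma T_meas : measurable_map M T.
Proof. apply HT. Qed.

Lemma Tinv_meas : measurable_map M Tinv.
Proof. apply HT. Qed.

Lemma T_Tinv (x : X) : T (Tinv x) = x.
Proof. apply HT. Qed.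

Lemma Tinv_T (x : X) : Tinv (T x) = x.
Proof. apply HT. Qed.

Lemma mu_preimage (A : X -> Prop) : M A -> mu (fun x => A (T x)) = mu A.
Proof. apply HT. Qed.

Lemma invertible_mpt_sym : invertible_mpt M mu Tinv T.
Proof.
  destruct HT as (H1 & H2 & H3 & H4 & H5). repeat split; auto.
  intros A HA. rewrite <- (H5 (fun x => A (Tinv x))) by now apply H4.
  f_equal. apply pred_ext. intros x. now rewrite H2.
Qed.

Lemma ergodic_sym : ergodic M mu Tinv.
Proof.
  intros A HA Hinv. apply Herg; auto. intros x. rewrite <- (Hinv (T x)), Tinv_T. tauto.
Qed.

Lemma iter_cancel (n m : nat) (x : X) :
  Nat.iter n Tinv (Nat.iter (n + m) T x) = Nat.iter m T x.
Proof.
  induction n as [|n IH]; auto.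
  rewrite iter_succ_r. cbn [Nat.add]. rewrite Nat.iter_succ, Tinv_T. apply IH.
Qed.

Lemma mu_iter_inv (n : nat) (A : X -> Prop) :
  M A -> mu (fun x => A (Nat.iter n Tinv x)) = mu A.
Proof.
  intros HA. induction n as [|n IH]; auto. rewrite <- IH.
  destruct invertible_mpt_sym as (_ & _ & _ & _ & H5).
  rewrite <- (H5 (fun x => A (Nat.iter n Tinv x))).
  - f_equal. apply pred_ext. intros x. now rewrite iter_succ_r.
  - apply meas_iter; auto. apply Tinv_meas.
Qed.

Lemma ergodic_positive (A : X -> Prop) :
  M A -> (forall x, A (T x) <-> A x) -> 0 < mu A -> mu A = 1.
Proof. intros HA Hi Hp. destruct (Herg A HA Hi); lra. Qed.

(** * The maximal inequality for simple functions *)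

Definition scomp (s : simple) : simple := map (fun p => (fst p, fun x => snd p (T x))) s.

Lemma seval_scomp (s : simple) (x : X) : seval (scomp s) x = seval s (T x).
Proof. induction s as [|p s IH]; simpl; auto. now rewrite IH. Qed.

Lemma smeas_scomp (s : simple) : smeas s -> smeas (scomp s).
Proof. intros H. induction H; simpl; constructor; auto. now apply T_meas. Qed.

Lemma sint_scomp (s : simple) : smeas s -> sint (scomp s) = sint s.
Proof.
  intros H. induction H as [|p s Hp Hs IH]; simpl; auto. now rewrite IH, mu_preimage.
Qed.

Fixpoint ssum (L : nat) (s : simple) : simple :=
  match L with
  | O => nil
  | S n => s ++ scomp (ssum n s)
  end.

Lemma seval_ssum (L : nat) (s : simple) (x : X) : seval (ssum L s) x = bsum T (seval s) L x.
Proof.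
  revert x. induction L as [|L IH]; intros x; [reflexivity|].
  rewrite bsum_succ, <- IH. simpl. now rewrite seval_app, seval_scomp.
Qed.

Lemma smeas_ssum (L : nat) (s : simple) : smeas s -> smeas (ssum L s).
Proof.
  intros Hs. induction L as [|L IH]; simpl; [constructor|].
  apply smeas_app; auto. now apply smeas_scomp.
Qed.

Lemma sint_ssum (L : nat) (s : simple) : smeas s -> sint (ssum L s) = INR L * sint s.
Proof.
  intros Hs. induction L as [|L IH]; [simpl; ring|].
  rewrite S_INR. simpl. rewrite sint_app, sint_scomp, IH by now apply smeas_ssum. ring.
Qed.

(* Integrate the greedy covering of a long orbit segment and divide by its length. *)
Lemma sint_nonpos (s : simple) (N : nat) : smeas s ->
  (forall x, exists n, (1 <= n <= N)%nat /\ bsum T (seval s) n x <= 0) -> sint s <= 0.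
Proof.
  intros Hs Hcov. destruct (seval_bounded s) as [B [HB Hb]].
  assert (H : forall L, INR L * sint s <= INR N * B).
  { intros L. rewrite <- sint_ssum by auto.
    replace (INR N * B) with (sint ((INR N * B, fun _ => True) :: nil))
      by (simpl; rewrite mu_full; ring).
    apply sint_mono.
    - now apply smeas_ssum.
    - repeat constructor. exact (meas_const True).
    - intros x. rewrite seval_ssum. simpl. rewrite ind_true by auto.
      rewrite Rmult_1_r, Rplus_0_r. apply sumn_greedy; auto.
      + intros i. apply Rle_trans with (2 := Hb (Nat.iter i T x)). apply Rle_abs.
      + intros j. destruct (Hcov (Nat.iter j T x)) as [n [Hn Hle]]. exists n. split; auto.
        erewrite sumn_ext; [exact Hle|]. intros i _. simpl.
        now rewrite Nat.add_comm, iter_add. }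
  apply Rnot_lt_le. intros Hpos.
  destruct (INR_unbounded (INR N * B / sint s)) as [L HL]. specialize (H L).
  apply Rmult_lt_compat_r with (r := sint s) in HL; auto.
  unfold Rdiv in HL. rewrite Rmult_assoc, Rinv_l in HL; lra.
Qed.

(** The set [I] where the upper limit of the averages is at least [l] is invariant, hence null or of
    full measure. Off [I] the averages are eventually at most [l]; on [I] they exceed [l']
    infinitely often. *)
Lemma birkhoff_dichotomy (f : X -> R) (l' l : R) : measurable_fun M f -> l' < l ->
  ae M mu (fun x => eventually (fun n => bsum T f n x <= l * INR n)) \/
  ae M mu (fun x => frequently (fun n => l' * INR n < bsum T f n x)).
Proof.
  intros Hf Hl.
  set (I := fun x => forall m : nat,
    frequently (fun n => (l - / INR (S m)) * INR n < bsum T f n x)).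
  assert (HI : M I).
  { apply meas_all; intros m.
    apply (meas_frequently (fun n x => (l - / INR (S m)) * INR n < bsum T f n x)).
    intros n. apply meas_lt; [apply mfun_const | apply mfun_bsum; auto; apply T_meas]. }
  assert (HIe : forall x, I x -> forall e, 0 < e ->
    frequently (fun n => (l - e) * INR n < bsum T f n x)).
  { intros x Hx e He N. destruct (inv_INR_S_lt e He) as [m Hm].
    destruct (Hx m N) as [n [Hn H]]. exists n. split; auto.
    pose proof (pos_INR n). nra. }
  (* Passing between [x] and [T x] changes the sum by [f x] and the length by one; half of the
     tolerance [d] pays for both when [n] is large. *)
  assert (Hinv : forall x, I (T x) <-> I x).
  { intros x. split; intros Hx m N; pose proof (inv_INR_S_pos m) as Hd;
      set (d := / INR (S m)) in *.
    - destruct (eventually_INR_ge ((l - d - f x) / (d / 2))) as [N1 HN1].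
      destruct (HIe _ Hx (d / 2) ltac:(lra) (N + N1)%nat) as [n [Hn H]].
      exists (S n). split; [lia|]. rewrite bsum_succ, S_INR.
      specialize (HN1 n ltac:(lia)).
      apply Rmult_le_compat_l with (r := d / 2) in HN1; [|lra].
      replace (d / 2 * ((l - d - f x) / (d / 2))) with (l - d - f x) in HN1 by (field; lra).
      lra.
    - destruct (eventually_INR_ge ((f x - l + d / 2) / (d / 2))) as [N1 HN1].
      destruct (HIe _ Hx (d / 2) ltac:(lra) (S (N + N1))%nat) as [n [Hn H]].
      destruct n as [|n]; [lia|]. exists n. split; [lia|]. rewrite bsum_succ, S_INR in H.
      specialize (HN1 n ltac:(lia)).
      apply Rmult_le_compat_l with (r := d / 2) in HN1; [|lra].
      replace (d / 2 * ((f x - l + d / 2) / (d / 2))) with (f x - l + d / 2) in HN1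
        by (field; lra).
      lra. }
  destruct (Herg I HI Hinv) as [H|H].
  - left. exists I. repeat split; auto. intros x Hx. apply NNPP. intros H1. apply Hx.
    apply not_eventually in H1. intros m N. destruct (H1 N) as [n [Hn H2]].
    exists n. split; auto. pose proof (inv_INR_S_pos m). pose proof (pos_INR n). nra.
  - right. apply ae_mono with I; [|now apply ae_of_mu1].
    intros x Hx N. destruct (HIe x Hx (l - l') ltac:(lra) N) as [n [Hn H1]].
    exists n. split; auto. replace (l - (l - l')) with l' in H1; lra.
Qed.

(** Otherwise the averages of [k] exceed [c + 2 d] infinitely often, almost everywhere. A staircase
    below [k] loses at most [d], so its averages exceed [c + d] within time [N] on a set [D N] whose
    measure tends to 1. The maximal inequality gives [(c + d) * mu (D N) <= c], a contradiction. *)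
Lemma birkhoff_upper (k : X -> R) (c l : R) : measurable_fun M k -> (forall x, 0 <= k x) ->
  int_le k c -> c < l -> ae M mu (fun x => eventually (fun n => bsum T k n x <= l * INR n)).
Proof.
  intros Hk Hk0 Hc Hcl. pose proof (int_le_ge0 k c Hk0 Hc) as Hc0.
  set (d := (l - c) / 4).
  destruct (birkhoff_dichotomy k (c + 2 * d) l Hk ltac:(unfold d; lra)) as [H|Hfreq]; auto.
  exfalso. assert (Hd : 0 < d) by (unfold d; lra). clearbody d. clear Hcl l.
  set (s := staircase k d).
  assert (Hs : forall N, smeas (s N)) by (intros N; now apply smeas_staircase).
  set (D := fun N x => exists n, (1 <= n <= N)%nat /\ (c + d) * INR n < bsum T (seval (s N)) n x).
  assert (HD : forall N, M (D N)).
  { intros N. apply meas_ex; intros n. apply meas_and; [apply meas_const|].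
    apply meas_lt; [apply mfun_const | apply mfun_bsum; [apply T_meas | now apply mfun_seval]]. }
  assert (Hfull : mu (fun x => exists N, D N x) = 1).
  { apply mu1_of_ae; [now apply meas_ex|]. apply ae_mono with (2 := Hfreq). intros x Hx.
    destruct (Hx 1%nat) as [n [Hn H]].
    destruct (eventually_and _ _ (eventually_nat_ge n)
      (eventually_forall_lt n _ (fun i => eventually_INR_ge (k (Nat.iter i T x) / d))))
      as [N HN].
    destruct (HN N (le_n N)) as [HnN Hki]. exists N, n. split; [lia|].
    assert (Hle : bsum T k n x <= bsum T (seval (s N)) n x + INR n * d).
    { unfold bsum. rewrite <- sumn_const, <- sumn_plus. apply sumn_le. intros i Hi.
      apply staircase_approx; auto. specialize (Hki i Hi).
      apply Rmult_le_compat_r with (r := d) in Hki; [|lra].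
      unfold Rdiv in Hki. rewrite Rmult_assoc, Rinv_l in Hki; lra. }
    lra. }
  assert (HDle : forall N, (c + d) * mu (D N) <= c).
  { intros N.
    (* The function [(c + d) 1_{D N} - s N] has a nonpositive sum over some [n <= N] steps from a
       point of [D N], and over one step from any other point. The bound [S N] admits that single
       step also when [N = 0]. *)
    assert (H : sint (((c + d), D N) :: sopp (s N)) <= 0).
    { apply sint_nonpos with (S N).
      - constructor; [apply HD | now apply smeas_sopp].
      - intros x.
        assert (Hu : forall n y, bsum T (seval ((c + d, D N) :: sopp (s N))) n y <=
                  (c + d) * INR n - bsum T (seval (s N)) n y).
        { intros n y. unfold bsum.
          replace ((c + d) * INR n - sumn n (fun i => seval (s N) (Nat.iter i T y)))
            with (sumn n (fun i => (c + d) + -1 * seval (s N) (Nat.iter i T y)))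
            by (rewrite sumn_plus, sumn_const, sumn_scal; ring).
          apply sumn_le. intros i _. simpl. rewrite seval_sopp.
          pose proof (ind_bounds (D N) (Nat.iter i T y)). nra. }
        destruct (classic (D N x)) as [(n & Hn & H)|Hx].
        + exists n. split; [lia|]. specialize (Hu n x). lra.
        + exists 1%nat. split; [lia|]. unfold bsum. simpl.
          rewrite ind_false, seval_sopp by auto.
          destruct (staircase_approx k d N x Hd (Hk0 x)) as [H _].
          fold (s N) in H. lra. }
    simpl in H. rewrite sint_sopp in H.
    assert (sint (s N) <= c); [|lra].
    apply Hc; auto. intros x. now apply staircase_approx. }
  destruct (mu_below_gt D (c / (c + d))) as [N HN]; auto.
  - intros N x (n & Hn & H). exists n. split; [lia|].
    apply Rlt_le_trans with (1 := H). apply bsum_le. intros y. now apply staircase_incr.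
  - rewrite Hfull. apply Rmult_lt_reg_r with (c + d); [lra|].
    unfold Rdiv. rewrite Rmult_assoc, Rinv_l; lra.
  - specialize (HN N (le_n N)). specialize (HDle N).
    apply Rmult_lt_compat_r with (r := c + d) in HN; [|lra].
    unfold Rdiv in HN. rewrite Rmult_assoc, Rinv_l in HN; lra.
Qed.

(** Let [D N] be the set where some average of [k] up to time [N] is at most [l], and let [B] bound
    the simple function [s <= k]. The maximal inequality for [s - l - B 1_{not D N}] gives
    [sint s <= l + B * (1 - mu (D N))], and [mu (D N)] tends to 1. *)
Lemma birkhoff_int_le (k : X -> R) (l : R) : measurable_fun M k -> (forall x, 0 <= k x) ->
  0 <= l -> ae M mu (fun x => frequently (fun n => bsum T k n x <= l * INR n)) -> int_le k l.
Proof.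
  intros Hk Hk0 Hl Hfreq s Hs Hsk. destruct (seval_bounded s) as [B [HB Hb]].
  set (D := fun N x => exists n, (1 <= n <= N)%nat /\ bsum T k n x <= l * INR n).
  assert (HD : forall N, M (D N)).
  { intros N. apply meas_ex; intros n. apply meas_and; [apply meas_const|].
    apply meas_le; [apply mfun_bsum; auto; apply T_meas | apply mfun_const]. }
  assert (Hfull : mu (fun x => exists N, D N x) = 1).
  { apply mu1_of_ae; [now apply meas_ex|]. apply ae_mono with (2 := Hfreq). intros x Hx.
    destruct (Hx 1%nat) as [n [Hn H]]. exists n, n. split; [lia | auto]. }
  assert (HDle : forall N, sint s <= l + B * (1 - mu (D N))).
  { intros N.
    set (u := (- l, fun _ => True) :: (- B, fun x => ~ D N x) :: s).
    assert (H : sint u <= 0).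
    { apply sint_nonpos with (S N).
      - constructor; [exact (meas_const True)|]. constructor; [exact (meas_not _ (HD N)) | auto].
      - intros x. destruct (classic (D N x)) as [(n & Hn & H)|Hx].
        + exists n. split; [lia|].
          apply Rle_trans with (bsum T (fun y => k y - l) n x).
          * apply bsum_le. intros y. simpl. rewrite (ind_true (fun _ => True)) by auto.
            pose proof (ind_bounds (fun z => ~ D N z) y). specialize (Hsk y). nra.
          * rewrite bsum_sub_const. lra.
        + exists 1%nat. split; [lia|]. unfold bsum. simpl.
          rewrite (ind_true (fun _ => True)), (ind_true (fun z => ~ D N z)) by auto.
          specialize (Hb x). pose proof (Rle_abs (seval s x)). lra. }
    unfold u in H. simpl in H. rewrite mu_full, mu_not in H by auto. lra. }
  apply Rnot_lt_le. intros Hlt.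
  (* Dividing by [B + 1] rather than [B] covers the case [B = 0]. *)
  assert (HB' : 0 < B + 1) by lra.
  destruct (mu_below_gt D (1 - (sint s - l) / (B + 1))) as [N HN]; auto.
  - intros N x (n & Hn & H). exists n. split; [lia | auto].
  - rewrite Hfull. assert (0 < (sint s - l) / (B + 1)); [|lra].
    apply Rdiv_lt_0_compat; lra.
  - specialize (HN N (le_n N)). specialize (HDle N).
    set (e := (sint s - l) / (B + 1)) in *.
    assert (He : sint s - l = e * (B + 1)) by (unfold e; field; lra).
    pose proof (mu_le1 _ (HD N)). assert (0 < e); nra.
Qed.

Lemma visits_density (A : X -> Prop) (a : R) : M A -> 1 - a < mu A ->
  ae M mu (fun x => eventually (fun n =>
    sumn n (fun i => ind (fun y => ~ A y) (Nat.iter i T x)) <= a * INR n)).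
Proof.
  intros HA Ha. apply (birkhoff_upper (ind (fun y => ~ A y)) (mu (fun y => ~ A y))).
  - now apply mfun_ind, meas_not.
  - intros x. apply ind_bounds.
  - now apply int_le_ind, meas_not.
  - rewrite mu_not by auto. lra.
Qed.

Lemma iter_cancel_l (n m : nat) (x : X) :
  Nat.iter n T (Nat.iter (n + m) Tinv x) = Nat.iter m Tinv x.
Proof.
  induction n as [|n IH]; auto.
  rewrite iter_succ_r. cbn [Nat.add]. rewrite Nat.iter_succ, T_Tinv. apply IH.
Qed.

(** * One-sided bounds from bilateral ones *)

(** The points that visit [E] at some positive or negative time form an invariant set of positive
    measure, hence of full measure, so most points have a visit in [[-K, K]]. Starting [K] steps
    earlier turns this window into [[0, 2 K]]. Forward visits alone would give only one direction of
    the invariance. *)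
Lemma visits_within (E : X -> Prop) (a : R) : M E -> 0 < mu E -> a < 1 ->
  exists K : nat, a < mu (fun x => exists m, (m <= K)%nat /\ E (Nat.iter m T x)).
Proof.
  intros HE Hpos Ha.
  set (O := fun K x => exists m, (m <= K)%nat /\ (E (Nat.iter m T x) \/ E (Nat.iter m Tinv x))).
  assert (HO : forall K, M (O K)).
  { intros K. apply meas_ex; intros m. apply meas_and; [apply meas_const|].
    apply meas_or; apply meas_iter; auto; [apply T_meas | apply Tinv_meas]. }
  assert (Hfull : mu (fun x => exists K, O K x) = 1).
  { apply ergodic_positive.
    - now apply meas_ex.
    - intros x. split; intros (K & m & Hm & H).
      + destruct H as [H|H].
        * exists (S m), (S m). rewrite iter_succ_r. auto.
        * destruct m as [|m]; [exists 1%nat, 1%nat; auto|].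
          exists m, m. rewrite iter_succ_r, Tinv_T in H. auto.
      + destruct H as [H|H].
        * destruct m as [|m].
          -- exists 1%nat, 1%nat. simpl. rewrite Tinv_T. auto.
          -- exists m, m. rewrite iter_succ_r in H. auto.
        * exists (S m), (S m). rewrite iter_succ_r, (iter_succ_r Tinv), Tinv_T. auto.
    - apply Rlt_le_trans with (1 := Hpos). apply mu_mono; auto; [now apply meas_ex|].
      intros x Hx. exists 0%nat, 0%nat. auto. }
  destruct (mu_below_gt O a) as [K HK]; auto.
  - intros K x (m & Hm & H). exists m. auto.
  - rewrite Hfull. lra.
  - specialize (HK K (le_n K)). exists (2 * K)%nat. apply Rlt_le_trans with (1 := HK).
    set (C := fun x => exists m, (m <= 2 * K)%nat /\ E (Nat.iter m T x)).
    assert (HC : M C).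
    { apply meas_ex; intros m. apply meas_and; [apply meas_const|].
      apply meas_iter; auto. apply T_meas. }
    rewrite <- (mu_iter_inv K C) by auto.
    apply mu_mono; auto; [apply meas_iter; auto; apply Tinv_meas|].
    intros x (m & Hm & [H|H]).
    + exists (m + K)%nat. split; [lia|]. rewrite iter_add.
      pose proof (iter_cancel_l K 0 x) as H1. rewrite Nat.add_0_r in H1.
      now rewrite H1.
    + exists (K - m)%nat. split; [lia|].
      pose proof (iter_cancel_l (K - m) m x) as H1.
      replace (K - m + m)%nat with K in H1 by lia. now rewrite H1.
Qed.

(** The sets [G t] increase to the whole space, since finitely many real values at each point have a
    common bound. *)
Lemma bsum_tight (h : X -> R) (K : nat) (a : R) : measurable_fun M h -> a < 1 ->
  exists t : R, M (fun x => forall m, (m <= K)%nat -> Rabs (bsum T h m x) <= t) /\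
    a < mu (fun x => forall m, (m <= K)%nat -> Rabs (bsum T h m x) <= t).
Proof.
  intros Hh Ha.
  set (G := fun (t : nat) x => forall m, (m <= K)%nat -> Rabs (bsum T h m x) <= INR t).
  assert (HG : forall t, M (G t)).
  { intros t. apply meas_all; intros m. apply meas_imp; [apply meas_const|].
    apply meas_le; [|apply mfun_const]. unfold Rabs.
    replace (fun x => if Rcase_abs (bsum T h m x) then - bsum T h m x else bsum T h m x)
      with (fun x => Rmax (bsum T h m x) (- bsum T h m x)).
    - apply mfun_max; [|apply mfun_opp]; apply mfun_bsum; auto; apply T_meas.
    - apply functional_extensionality. intros x. unfold Rmax.
      destruct Rle_dec, Rcase_abs; lra. }
  destruct (mu_below_gt G a) as [t Ht]; auto.
  - intros t x H m Hm. specialize (H m Hm). rewrite S_INR. lra.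
  - replace (fun x => exists t, G t x) with (fun _ : X => True); [rewrite mu_full; lra|].
    apply pred_ext. intros x. split; auto. intros _.
    destruct (eventually_forall_lt (S K) _
      (fun m => eventually_INR_ge (Rabs (bsum T h m x)))) as [t Ht].
    exists t. intros m Hm. apply (Ht t); lia.
  - exists (INR t). split; [apply HG|]. apply Ht. lia.
Qed.

(* A visit [v] of the orbit of [x] to [E] reflects the sums [w i = bsum T h i x] about
   [v]: [w (2 v + p - i) <= w i]. Hence [w] is small at the points [2 v + p] and at least
   [w n] at the points [2 v + p - n]. Since [w] varies little over bounded distances, up to a
   set of small density, both kinds of points fill most of [[0, n]], and a common point
   bounds [w n]. *)
Lemma bilateral_reflection (h : X -> R) (p : Z) (N : nat) : measurable_fun M h ->
  (Z.abs p <= Z.of_nat N)%Z ->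
  0 < mu (fun x => forall n, (n >= N)%nat ->
    bsum T h (Z.to_nat (2 * Z.of_nat n + p)) (Nat.iter n Tinv x) <= 0) ->
  exists t, ae M mu (fun x => eventually (fun n => bsum T h n x <= t)).
Proof.
  intros Hh Hp. set (E := fun x => _). intros HE.
  assert (HEM : M E).
  { apply meas_all; intros n. apply meas_imp; [apply meas_const|].
    apply meas_le; [|apply mfun_const].
    apply (mfun_iter Tinv n (bsum T h (Z.to_nat (2 * Z.of_nat n + p)))); [apply Tinv_meas|].
    apply mfun_bsum; auto. apply T_meas. }
  destruct (visits_within E (9 / 10) HEM HE) as [K HK]; [lra|].
  set (C := fun x => exists m, (m <= K)%nat /\ E (Nat.iter m T x)) in HK.
  assert (HC : M C).
  { apply meas_ex; intros m. apply meas_and; [apply meas_const|].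
    apply meas_iter; auto. apply T_meas. }
  (* [2 K + 1] covers the offsets [2 m1] and [e + 2 m2] used below, where [m1, m2 <= K] and
     [e <= 1]. *)
  destruct (bsum_tight h (2 * K + 1) (9 / 10) Hh) as [t [HGM HG]]; [lra|].
  set (G := fun x => forall m, (m <= 2 * K + 1)%nat -> Rabs (bsum T h m x) <= t) in *.
  exists (2 * t).
  pose proof (ae_and _ _ (visits_density C (1 / 10) HC ltac:(lra))
    (visits_density G (1 / 10) HGM ltac:(lra))) as Hae.
  apply ae_mono with (2 := Hae). clear Hae. intros x [HxC HxG].
  set (w := fun i => bsum T h i x).
  assert (Hrefl : forall v n, (N <= n <= v)%nat -> E (Nat.iter v T x) ->
    w (v - n + Z.to_nat (2 * Z.of_nat n + p))%nat <= w (v - n)%nat).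
  { intros v n Hn Hv. specialize (Hv n ltac:(lia)).
    pose proof (iter_cancel n (v - n) x) as Hc.
    replace (n + (v - n))%nat with v in Hc by lia. rewrite Hc in Hv.
    unfold w. rewrite bsum_add. lra. }
  assert (Hnear : forall b m, G (Nat.iter b T x) -> (m <= 2 * K + 1)%nat ->
    - t <= w (b + m)%nat - w b <= t).
  { intros b m Hb Hm. specialize (Hb m Hm). unfold w. rewrite bsum_add.
    revert Hb. unfold Rabs. destruct Rcase_abs; lra. }
  eapply eventually_mono; [| exact (eventually_and _ _ (eventually_and _ _ HxC HxG)
    (eventually_nat_ge (10 * (K + 4 * N) + 10)%nat))].
  intros n [[HnC HnG] Hn]. cbv beta in *.
  set (uC := fun i => ind (fun y => ~ C y) (Nat.iter i T x)) in *.
  set (uG := fun i => ind (fun y => ~ G y) (Nat.iter i T x)) in *.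
  assert (HuC : forall i, 0 <= uC i) by (intros i; apply (proj1 (ind_bounds _ _))).
  assert (HuG : forall i, 0 <= uG i) by (intros i; apply (proj1 (ind_bounds _ _))).
  pose proof (Nat.div_mod_eq n 2) as Hdiv. pose proof (Nat.mod_upper_bound n 2) as Hmod.
  set (r := (n / 2)%nat) in *. set (e := (n mod 2)%nat) in *.
  (* Reflecting 0 in [2 N + i] gives [b = b0 + 2 i]; as [n = 2 r + e], reflecting [n] in
     [2 N + r + e + i] gives [b + e]. The offset [2 N] keeps the visits beyond time [N], and for
     [i < H] all these positions lie below [n]. *)
  set (H := (r - K - 4 * N)%nat). set (b0 := Z.to_nat (4 * Z.of_nat N + p)).
  destruct (sumn_lt_length H (fun i =>
    (uC (2 * N + i)%nat + uC (2 * N + r + e + i)%nat) + uG (b0 + 2 * i)%nat))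
    as (i & Hi & Hlt).
  - rewrite !sumn_plus.
    pose proof (sumn_shift_le H (2 * N) uC HuC).
    pose proof (sumn_shift_le H (2 * N + r + e) uC HuC).
    pose proof (sumn_even_le H (fun i => uG (b0 + i)%nat) (fun i => HuG _)).
    pose proof (sumn_shift_le (2 * H) b0 uG HuG).
    pose proof (sumn_incr (2 * N + H) n uC HuC ltac:(lia)).
    pose proof (sumn_incr (2 * N + r + e + H) n uC HuC ltac:(lia)).
    pose proof (sumn_incr (b0 + 2 * H) n uG HuG ltac:(lia)).
    (* Each of the three counts of bad positions is at most [n / 10], while [H] is close to
       [n / 2]. *)
    assert (3 * INR n < 10 * INR H); [|lra].
    replace 3 with (INR 3) by (simpl; ring). replace 10 with (INR 10) by (simpl; ring).
    rewrite <- !mult_INR. apply lt_INR. lia.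
  - pose proof (HuC (2 * N + i)%nat). pose proof (HuC (2 * N + r + e + i)%nat).
    pose proof (HuG (b0 + 2 * i)%nat).
    assert (Hb : G (Nat.iter (b0 + 2 * i) T x)) by (apply ind_lt1; unfold uG in *; lra).
    assert (V1 : C (Nat.iter (2 * N + i) T x)) by (apply ind_lt1; unfold uC in *; lra).
    assert (V2 : C (Nat.iter (2 * N + r + e + i) T x)) by (apply ind_lt1; unfold uC in *; lra).
    set (b := (b0 + 2 * i)%nat) in *.
    destruct V1 as (m1 & Hm1 & V1). destruct V2 as (m2 & Hm2 & V2).
    rewrite <- iter_add in V1, V2.
    set (v1 := (m1 + (2 * N + i))%nat) in *.
    set (v2 := (m2 + (2 * N + r + e + i))%nat) in *.
    (* The radius [v1] puts the left end of the window at 0, and the radius in [L2] puts the right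
       end at [n]. Together with [Hnear], [w n <= w (b + e + 2 m2) <= w b + t <= w (b + 2 m1) + 2 t
       <= 2 t]. *)
    pose proof (Hrefl v1 v1 ltac:(lia) V1) as L1.
    pose proof (Hrefl v2 (Z.to_nat (Z.of_nat r - Z.of_nat (2 * N + i) - Z.of_nat m2 - p))
      ltac:(lia) V2) as L2.
    replace (v1 - v1 + Z.to_nat (2 * Z.of_nat v1 + p))%nat with (b + 2 * m1)%nat in L1 by lia.
    replace (v1 - v1)%nat with 0%nat in L1 by lia. change (w 0%nat) with 0 in L1.
    replace (v2 - Z.to_nat (Z.of_nat r - Z.of_nat (2 * N + i) - Z.of_nat m2 - p))%nat
      with (b + (e + 2 * m2))%nat in L2 by lia.
    replace (b + (e + 2 * m2) + Z.to_nat (2 * Z.of_nat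
      (Z.to_nat (Z.of_nat r - Z.of_nat (2 * N + i) - Z.of_nat m2 - p)) + p))%nat
      with n in L2 by lia.
    pose proof (Hnear b (2 * m1)%nat Hb ltac:(lia)).
    pose proof (Hnear b (e + 2 * m2)%nat Hb ltac:(lia)).
    unfold w in *. lra.
Qed.

(** The reflection argument is applied to [f - a], on a set of positive measure where the bound
    holds from a common time on. The constant bound [t] that results is at most [(a' - a) n] for
    large [n]. *)
Lemma upper_of_bilateral (f : X -> R) (p : Z) (a a' : R) : measurable_fun M f -> a < a' ->
  0 < mu (fun x => eventually (fun n =>
    bsum T f (Z.to_nat (2 * Z.of_nat n + p)) (Nat.iter n Tinv x)
      <= a * IZR (2 * Z.of_nat n + p))) ->
  ae M mu (fun x => eventually (fun n => bsum T f n x <= a' * INR n)).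
Proof.
  intros Hf Ha Hpos. set (h := fun y => f y - a).
  assert (Hh : measurable_fun M h) by (apply mfun_sub; auto; apply mfun_const).
  (* The second condition makes the window length nonnegative, so that [Z.to_nat] does not truncate
     it. *)
  set (E := fun N x => forall n, (n >= N)%nat -> (n >= Z.to_nat (Z.abs p))%nat ->
    bsum T h (Z.to_nat (2 * Z.of_nat n + p)) (Nat.iter n Tinv x) <= 0).
  assert (Hfh : forall n x, (n >= Z.to_nat (Z.abs p))%nat ->
    bsum T f (Z.to_nat (2 * Z.of_nat n + p)) x <= a * IZR (2 * Z.of_nat n + p) ->
    bsum T h (Z.to_nat (2 * Z.of_nat n + p)) x <= 0).
  { intros n x Hn H. unfold h. rewrite bsum_sub_const, INR_IZR_INZ, Z2Nat.id by lia. lra. }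
  assert (HEM : forall N, M (E N)).
  { intros N. apply meas_all; intros n. do 2 (apply meas_imp; [apply meas_const|]).
    apply meas_le; [|apply mfun_const].
    apply (mfun_iter Tinv n (bsum T h (Z.to_nat (2 * Z.of_nat n + p)))); [apply Tinv_meas|].
    apply mfun_bsum; auto. apply T_meas. }
  assert (HEx : 0 < mu (fun x => exists N, E N x)).
  { apply Rlt_le_trans with (1 := Hpos). apply mu_mono.
    - apply (meas_eventually (fun n x => bsum T f (Z.to_nat (2 * Z.of_nat n + p))
        (Nat.iter n Tinv x) <= a * IZR (2 * Z.of_nat n + p))).
      intros n. apply meas_le; [|apply mfun_const].
      apply (mfun_iter Tinv n (bsum T f (Z.to_nat (2 * Z.of_nat n + p)))); [apply Tinv_meas|].
      apply mfun_bsum; auto. apply T_meas.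
    - now apply meas_ex.
    - intros x [N HN]. exists N. intros n H1 H2. apply Hfh; auto. }
  destruct (mu_below_gt E 0 HEM) as [N HN]; auto.
  { intros N x H n Hn. apply H. lia. }
  destruct (bilateral_reflection h p (N + Z.to_nat (Z.abs p)) Hh) as [t Ht]; [lia| |].
  - apply Rlt_le_trans with (1 := HN (N + Z.to_nat (Z.abs p))%nat ltac:(lia)).
    apply Req_le. f_equal. apply pred_ext. intros x. split.
    + intros H n Hn. apply H; lia.
    + intros H n H1 H2. apply H. lia.
  - apply ae_mono with (2 := Ht). intros x Hx.
    eapply eventually_mono;
      [| exact (eventually_and _ _ Hx (eventually_INR_ge (t / (a' - a))))].
    intros n [H1 H2]. unfold h in H1. rewrite bsum_sub_const in H1.
    apply Rmult_le_compat_r with (r := a' - a) in H2; [|lra].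
    unfold Rdiv in H2. rewrite Rmult_assoc, Rinv_l in H2; lra.
Qed.

(** * Time reversal and the lower bound *)

Lemma bsum_reverse (f : X -> R) (m : nat) (x : X) :
  bsum Tinv f (S m) (Nat.iter m T x) = bsum T f (S m) x.
Proof.
  unfold bsum. rewrite <- (sumn_rev (S m) (fun i => f (Nat.iter i T x))).
  apply sumn_ext. intros i Hi. f_equal.
  pose proof (iter_cancel i (S m - 1 - i) x) as H.
  now replace (i + (S m - 1 - i))%nat with m in H by lia.
Qed.

(** [g x] is the supremum over [n] of [bsum T h n x], with default 0 where these sums are unbounded
    above. The term [n = 0] gives [0 <= g x], and [h x + bsum T h n (T x) <= g x] gives the other
    inequality. *)
Lemma sup_transfer (h : X -> R) : measurable_fun M h -> exists g : X -> R,
  measurable_fun M g /\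
  forall x, (exists a : nat, forall n, bsum T h n x <= INR a) ->
    0 <= g x /\ g (T x) <= g x - h x.
Proof.
  intros Hh.
  set (B := fun x => exists a : nat, forall n, bsum T h n x <= INR a).
  assert (Hex : forall x, exists l,
    (B x -> is_lub (fun y => exists n, y = bsum T h n x) l) /\ (~ B x -> l = 0)).
  { intros x. destruct (classic (B x)) as [Hx|Hx].
    - destruct (completeness (fun y => exists n, y = bsum T h n x)) as [l Hl].
      + destruct Hx as [a Ha]. exists (INR a). intros y [n Hn]. subst. apply Ha.
      + exists 0. now exists 0%nat.
      + exists l. tauto.
    - exists 0. tauto. }
  apply choice in Hex. destruct Hex as [g Hg]. exists g.
  assert (HbM : forall n, measurable_fun M (bsum T h n))
    by (intros n; apply mfun_bsum; auto; apply T_meas).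
  assert (Hge : forall x n, B x -> bsum T h n x <= g x).
  { intros x n Hx. destruct (proj1 (Hg x) Hx) as [Hub _]. apply Hub. now exists n. }
  assert (Hle : forall x a, B x -> (forall n, bsum T h n x <= a) -> g x <= a).
  { intros x a Hx Ha. destruct (proj1 (Hg x) Hx) as [_ Hl]. apply Hl.
    intros y [n Hn]. subst. apply Ha. }
  split.
  - intros a.
    (* The supremum is below [a] exactly when all terms stay below [a] by a uniform gap, and gaps
       [/ INR (S m)] suffice. *)
    replace (fun x => g x < a) with (fun x =>
      (B x /\ exists m : nat, forall n, bsum T h n x <= a - / INR (S m)) \/ (~ B x /\ 0 < a)).
    + assert (HB : M B).
      { apply meas_ex; intros b. apply meas_all; intros n. apply meas_le; auto.
        apply mfun_const. }
      apply meas_or; apply meas_and; auto using meas_not, meas_const.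
      apply meas_ex; intros m. apply meas_all; intros n. apply meas_le; auto.
      apply mfun_const.
    + apply pred_ext. intros x. split.
      * intros [[Hx [m Hm]]|[Hx Ha]].
        -- apply Hle in Hm; auto. pose proof (inv_INR_S_pos m). lra.
        -- rewrite (proj2 (Hg x) Hx). auto.
      * intros Ha. destruct (classic (B x)) as [Hx|Hx].
        -- left. split; auto. destruct (inv_INR_S_lt (a - g x)) as [m Hm]; [lra|].
           exists m. intros n. specialize (Hge x n Hx). lra.
        -- right. split; auto. rewrite (proj2 (Hg x) Hx) in Ha. auto.
  - intros x Hx. split.
    + exact (Hge x 0%nat Hx).
    + assert (Hn : forall n, bsum T h n (T x) <= g x - h x).
      { intros n. pose proof (Hge x (S n) Hx) as H. rewrite bsum_succ in H. lra. }
      apply Hle; auto. destruct (INR_unbounded (g x - h x)) as [a Ha].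
      exists a. intros n. specialize (Hn n). lra.
Qed.

(* With [h = f - d], the sums [V n] of [h] are bounded above, and [g = sup_n V n] gives
   [h = g - g o T - k] with [k >= 0]. As [V n >= - 2 d n] infinitely often, the averages of
   [k] stay below [4 d]. If [b] lies between [n] and [2 n] and the backward sums at
   [T^b x] are nonpositive, then [V (b + 1) <= V n], which bounds [g (T^n x)] by
   [g (T^(b+1) x) + 8 d n]; and [g (T^(b+1) x)] is bounded for most [b]. *)
Lemma lower_of_upper (f : X -> R) : measurable_fun M f ->
  (forall e, 0 < e -> ae M mu (fun x => eventually (fun n => bsum T f n x <= e * INR n))) ->
  (forall e, 0 < e -> ae M mu (fun x => eventually (fun n => bsum Tinv f n x <= e * INR n))) ->
  (forall e, 0 < e -> ae M mu (fun x => frequently (fun n => - (e * INR n) <= bsum T f n x))) ->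
  forall e, 0 < e -> ae M mu (fun x => eventually (fun n => - (e * INR n) <= bsum T f n x)).
Proof.
  intros Hf Hup Hback Hfreq e He.
  (* The final estimate is [V n >= V (b + 1) >= - INR N - 4 d (b + 1) >= - 16 d n], which 20 leaves
     room for. *)
  set (d := e / 20). assert (Hd : 0 < d) by (unfold d; lra).
  set (h := fun y => f y - d).
  assert (Hh : measurable_fun M h) by (apply mfun_sub; auto; apply mfun_const).
  assert (HV : forall S n x, bsum S h n x = bsum S f n x - INR n * d)
    by (intros; apply bsum_sub_const).
  set (B := fun x => exists a : nat, forall n, bsum T h n x <= INR a).
  assert (HBT : forall x, B x -> B (T x)).
  { intros x [a Ha]. destruct (INR_unbounded (INR a - h x)) as [a' Ha']. exists a'.
    intros n. specialize (Ha (S n)). rewrite bsum_succ in Ha. lra. }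
  assert (HBi : forall x n, B x -> B (Nat.iter n T x)).
  { intros x n Hx. induction n as [|n IH]; simpl; auto. }
  assert (HaeB : ae M mu B).
  { apply ae_mono with (2 := Hup d Hd). intros x [N HN].
    destruct (eventually_forall_lt N _ (fun i => eventually_INR_ge (bsum T h i x))) as [a Ha].
    exists a. intros n. destruct (Nat.lt_ge_cases n N) as [Hn|Hn].
    - apply (Ha a); lia.
    - specialize (HN n Hn). rewrite HV. pose proof (pos_INR a). lra. }
  destruct (sup_transfer h Hh) as [g [Hg HgB]]. fold B in HgB.
  (* The maximum makes [k] nonnegative everywhere; on [B], which [T] maps into itself, it equals its
     second argument by [HgB]. *)
  set (k := fun x => Rmax 0 (g x - g (T x) - h x)).
  assert (HgT : measurable_fun M (fun x => g (T x)))
    by exact (mfun_iter T 1 g T_meas Hg).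
  assert (Hk : measurable_fun M k).
  { apply mfun_max; [apply mfun_const|]. apply mfun_sub; auto. now apply mfun_sub. }
  assert (Hk0 : forall x, 0 <= k x) by (intros x; apply Rmax_l).
  assert (HK : forall x n, B x ->
    bsum T k n x = g x - g (Nat.iter n T x) - bsum T h n x).
  { intros x n Hx. induction n as [|n IH]; [unfold bsum; simpl; ring|].
    unfold bsum in *. cbn [sumn]. rewrite IH. unfold k at 1. rewrite Rmax_right.
    - simpl. ring.
    - destruct (HgB _ (HBi x n Hx)). lra. }
  (* One [d] comes from [h = f - d], one from the lower bound on the sums of [f], and one from
     [g x <= d n]. *)
  assert (Hint : int_le k (3 * d)).
  { apply birkhoff_int_le; auto; [lra|].
    apply ae_mono with (2 := ae_and _ _ HaeB (Hfreq d Hd)). intros x [Hx Hfx] N.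
    destruct (frequently_and_eventually _ _ Hfx (eventually_INR_ge (g x / d)) N)
      as (n & Hn & H1 & H2).
    exists n. split; auto. rewrite HK, HV by auto. destruct (HgB _ (HBi x n Hx)) as [H3 _].
    apply Rmult_le_compat_r with (r := d) in H2; [|lra].
    unfold Rdiv in H2. rewrite Rmult_assoc, Rinv_l in H2; lra. }
  pose proof (birkhoff_upper k (3 * d) (4 * d) Hk Hk0 Hint ltac:(lra)) as HaeK.
  set (A := fun (N : nat) y => (forall n, (n >= N)%nat -> bsum Tinv h n y <= 0) /\
    g (T y) <= INR N).
  assert (HA : forall N, M (A N)).
  { intros N. apply meas_and; [|apply meas_le; auto; apply mfun_const].
    apply meas_all; intros n. apply meas_imp; [apply meas_const|].
    apply meas_le; [apply mfun_bsum; auto; apply Tinv_meas | apply mfun_const]. }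
  assert (HAfull : mu (fun y => exists N, A N y) = 1).
  { apply mu1_of_ae; [now apply meas_ex|]. apply ae_mono with (2 := Hback d Hd).
    intros y [N HN]. destruct (eventually_INR_ge (g (T y))) as [a Ha].
    exists (N + a)%nat. split; [|apply Ha; lia].
    intros n Hn. specialize (HN n ltac:(lia)). rewrite HV. lra. }
  destruct (mu_below_gt A (9 / 10)) as [N HN]; auto.
  { intros N y [H1 H2]. split; [intros n Hn; apply H1; lia|]. rewrite S_INR. lra. }
  { rewrite HAfull. lra. }
  specialize (HN N (le_n N)).
  apply ae_mono with (2 := ae_and _ _ HaeB (ae_and _ _ HaeK
    (visits_density (A N) (1 / 10) (HA N) ltac:(lra)))).
  intros x (Hx & [N1 HN1] & [N2 HN2]).
  destruct (eventually_INR_ge (INR N / (8 * d))) as [N3 HN3].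
  exists (N1 + N2 + N3 + 10 * N + 10)%nat. intros n Hn.
  (* The search is for [b] with [n + N <= b < 2 n - 1]: at most [2 n / 10] of the times below [2 n]
     are bad. As [b - n >= N], the backward sum from [T^b x] down to [T^n x] is then nonpositive. *)
  destruct (sumn_lt_length (n - N - 1)
    (fun i => ind (fun y => ~ A N y) (Nat.iter (n + N + i) T x))) as (i & Hi & Hlt).
  { set (u := fun i => ind (fun y => ~ A N y) (Nat.iter i T x)) in *.
    assert (Hu : forall i, 0 <= u i) by (intros j; apply (proj1 (ind_bounds _ _))).
    pose proof (sumn_shift_le (n - N - 1) (n + N) u Hu) as S1.
    pose proof (sumn_incr (n + N + (n - N - 1)) (2 * n) u Hu ltac:(lia)) as S2.
    specialize (HN2 (2 * n)%nat ltac:(lia)).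
    assert (INR (2 * n) < 10 * INR (n - N - 1)).
    { replace 10 with (INR 10) by (simpl; ring). rewrite <- mult_INR. apply lt_INR. lia. }
    unfold u in *. lra. }
  apply ind_lt1 in Hlt. set (b := (n + N + i)%nat) in *. destruct Hlt as [Hb1 Hb2].
  assert (HVb : bsum T h (S b) x <= bsum T h n x).
  { specialize (Hb1 (S (b - n)) ltac:(lia)).
    assert (Hbn : Nat.iter b T x = Nat.iter (b - n) T (Nat.iter n T x))
      by (rewrite <- iter_add; f_equal; lia).
    rewrite Hbn, bsum_reverse in Hb1.
    replace (S b) with (n + S (b - n))%nat by lia. rewrite bsum_add. lra. }
  pose proof (HK x n Hx) as Kn. pose proof (HK x (S b) Hx) as Kb.
  pose proof (HN1 n ltac:(lia)) as Kn4. pose proof (HN1 (S b) ltac:(lia)) as Kb4.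
  pose proof (sumn_ge0 n (fun i => k (Nat.iter i T x)) (fun i => Hk0 _)) as Kn0.
  fold (bsum T k n x) in Kn0. rewrite (Nat.iter_succ b) in Kb.
  destruct (HgB x Hx) as [Hgx _]. pose proof (HV T n x) as HVn.
  assert (INR (S b) <= 2 * INR n).
  { replace 2 with (INR 2) by (simpl; ring). rewrite <- mult_INR. apply le_INR. lia. }
  specialize (HN3 n ltac:(lia)).
  apply Rmult_le_compat_r with (r := 8 * d) in HN3; [|lra].
  unfold Rdiv in HN3. rewrite Rmult_assoc, Rinv_l, Rmult_1_r in HN3 by lra.
  assert (4 * d * INR (S b) <= 8 * (d * INR n)) by nra.
  replace (e * INR n) with (20 * (d * INR n)) by (unfold d; field).
  assert (0 <= d * INR n) by (apply Rmult_le_pos; [lra | apply pos_INR]).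
  lra.
Qed.

End Dynamics.

(** * Bilateral averages *)

Section Bilateral.
Context (T Tinv : X -> X) (HT : invertible_mpt M mu T Tinv) (Herg : ergodic M mu T).

(** The unnormalised sum over the window from [-n] to [n + p - 1], as a forward sum from its left
    end. [Bq] corresponds to [p = 1 + q]. *)
Definition bil (f : X -> R) (p : Z) (n : nat) (x : X) : R :=
  bsum T f (Z.to_nat (2 * Z.of_nat n + p)) (Nat.iter n Tinv x).

Lemma mfun_bil (f : X -> R) (p : Z) (n : nat) :
  measurable_fun M f -> measurable_fun M (bil f p n).
Proof.
  intros Hf. apply (mfun_iter Tinv n (bsum T f (Z.to_nat (2 * Z.of_nat n + p)))); [apply HT|].
  apply mfun_bsum; auto. apply HT.
Qed.

Lemma bil_split (f : X -> R) (p : Z) (n : nat) (x : X) : (0 <= Z.of_nat n + p)%Z ->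
  bil f p n x = bsum Tinv f (S n) x - f x + bsum T f (Z.to_nat (Z.of_nat n + p)) x.
Proof.
  intros Hn. unfold bil.
  replace (Z.to_nat (2 * Z.of_nat n + p)) with (n + Z.to_nat (Z.of_nat n + p))%nat by lia.
  rewrite bsum_add. pose proof (iter_cancel_l T Tinv HT n 0 x) as H.
  rewrite Nat.add_0_r in H. simpl in H. rewrite H. f_equal.
  rewrite <- H at 2. rewrite (bsum_reverse T Tinv HT).
  unfold bsum at 2. cbn [sumn]. rewrite H. fold (bsum T f n (Nat.iter n Tinv x)). ring.
Qed.

Definition bil_below (f : X -> R) (p : Z) (a : R) (x : X) : Prop :=
  eventually (fun n => bil f p n x <= a * IZR (2 * Z.of_nat n + p)).

Lemma meas_bil_below (f : X -> R) (p : Z) (a : R) :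
  measurable_fun M f -> M (bil_below f p a).
Proof.
  intros Hf.
  apply (meas_eventually (fun n x => bil f p n x <= a * IZR (2 * Z.of_nat n + p))).
  intros n. apply meas_le; [now apply mfun_bil | apply mfun_const].
Qed.

Lemma bil_below_mono (f : X -> R) (p : Z) (a a' : R) (x : X) : a <= a' ->
  bil_below f p a x -> bil_below f p a' x.
Proof.
  intros Ha H.
  eapply eventually_mono; [| exact (eventually_and _ _ H (eventually_nat_ge (Z.abs_nat p)))].
  intros n [H1 H2]. apply Rle_trans with (1 := H1). apply Rmult_le_compat_r; auto.
  apply IZR_le. lia.
Qed.

Lemma forward_upper (f : X -> R) (p : Z) (a a' : R) : measurable_fun M f -> a < a' ->
  0 < mu (bil_below f p a) ->
  ae M mu (fun x => eventually (fun n => bsum T f n x <= a' * INR n)).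
Proof. intros Hf Ha Hpos. exact (upper_of_bilateral T Tinv HT Herg f p a a' Hf Ha Hpos). Qed.

(* Exchanging [T] and [Tinv] turns the window [[-n, n + q]] into [[-(n + q), n]], so that
   [n] becomes [n + q] and [p = q + 1] becomes [2 - p]. *)
Lemma backward_upper (f : X -> R) (p : Z) (a a' : R) : measurable_fun M f -> a < a' ->
  0 < mu (bil_below f p a) ->
  ae M mu (fun x => eventually (fun n => bsum Tinv f n x <= a' * INR n)).
Proof.
  intros Hf Ha Hpos.
  apply (upper_of_bilateral Tinv T (invertible_mpt_sym _ _ HT) (ergodic_sym _ _ HT Herg)
    f (2 - p) a a' Hf Ha).
  apply Rlt_le_trans with (1 := Hpos). apply mu_mono.
  - now apply meas_bil_below.
  - apply (meas_eventually (fun n x => bsum Tinv f (Z.to_nat (2 * Z.of_nat n + (2 - p)))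
      (Nat.iter n T x) <= a * IZR (2 * Z.of_nat n + (2 - p)))).
    intros n. apply meas_le; [|apply mfun_const].
    apply (mfun_iter T n (bsum Tinv f (Z.to_nat (2 * Z.of_nat n + (2 - p))))); [apply HT|].
    apply mfun_bsum; auto. apply HT.
  - intros x [N HN]. exists (N + 2 * Z.abs_nat p + 2)%nat. intros n' Hn'.
    set (n := Z.to_nat (Z.of_nat n' + 1 - p)).
    specialize (HN n ltac:(lia)). unfold bil in HN.
    replace (2 * Z.of_nat n + p)%Z with (2 * Z.of_nat n' + (2 - p))%Z in HN by lia.
    set (L := Z.to_nat (2 * Z.of_nat n' + (2 - p))) in *.
    replace L with (S (n' + n)) in * by lia.
    pose proof (iter_cancel_l T Tinv HT n 0 x) as H. rewrite Nat.add_0_r in H. simpl in H.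
    rewrite <- H at 1. rewrite <- iter_add, (bsum_reverse T Tinv HT). exact HN.
Qed.

(** [c] is the critical level for bilateral bounds. Levels just above it bound both one-sided sums
    from above. Below it the bound fails almost everywhere, so bilateral averages are at least
    [c - e] infinitely often; as neither half can be large, each half is close to [c] infinitely
    often, which is what [lower_of_upper] requires. *)
Lemma one_sided_averages_limit (f : X -> R) (p : Z) (c : R) : measurable_fun M f ->
  (forall e, 0 < e -> exists a, a < c + e /\ 0 < mu (bil_below f p a)) ->
  (forall e, 0 < e -> mu (bil_below f p (c - e)) = 0) ->
  forall e, 0 < e ->
    ae M mu (fun x => eventually (fun n => Rabs (bsum T f n x - c * INR n) <= e * INR n)) /\
    ae M mu (fun x => eventually (fun n => Rabs (bsum Tinv f n x - c * INR n) <= e * INR n)).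
Proof.
  intros Hf Habove Hbelow. set (f0 := fun y => f y - c).
  assert (Hf0 : measurable_fun M f0) by (apply mfun_sub; auto; apply mfun_const).
  assert (Hs : forall S n x, bsum S f0 n x = bsum S f n x - INR n * c)
    by (intros; apply bsum_sub_const).
  assert (Hup : forall e, 0 < e ->
    ae M mu (fun x => eventually (fun n => bsum T f0 n x <= e * INR n))).
  { intros e He. destruct (Habove e He) as (a & Ha & Hpos).
    apply ae_mono with (2 := forward_upper f p a (c + e) Hf Ha Hpos). intros x.
    apply eventually_mono. intros n H. rewrite Hs. lra. }
  assert (Hback : forall e, 0 < e ->
    ae M mu (fun x => eventually (fun n => bsum Tinv f0 n x <= e * INR n))).
  { intros e He. destruct (Habove e He) as (a & Ha & Hpos).
    apply ae_mono with (2 := backward_upper f p a (c + e) Hf Ha Hpos). intros x.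
    apply eventually_mono. intros n H. rewrite Hs. lra. }
  assert (Hbil : forall e, 0 < e -> ae M mu (fun x => frequently (fun n =>
    - (e * IZR (2 * Z.of_nat n + p)) <=
      bsum Tinv f0 (S n) x - f0 x + bsum T f0 (Z.to_nat (Z.of_nat n + p)) x))).
  { intros e He. exists (bil_below f p (c - e)). split; [now apply meas_bil_below|].
    split; auto. intros x Hx N.
    destruct (frequently_and_eventually _ _ (not_eventually _ Hx)
      (eventually_nat_ge (Z.abs_nat p)) N) as (n & Hn & H1 & H2).
    exists n. split; auto. rewrite bil_split in H1 by lia. rewrite !Hs. unfold f0.
    rewrite S_INR, (INR_IZR_INZ (Z.to_nat _)), Z2Nat.id by lia.
    rewrite !plus_IZR, mult_IZR in *. rewrite <- !INR_IZR_INZ in *. lra. }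
  set (r := Rabs (IZR p) + 1).
  assert (Hr : - r <= IZR p <= r) by (unfold r, Rabs; destruct Rcase_abs; lra).
  (* Per unit of [n], the bilateral bound costs [2 e / 4] and the backward half [e / 4]; the
     remaining [e / 4] absorbs the terms in [f0 x] and [p]. *)
  assert (Hfreq : forall e, 0 < e ->
    ae M mu (fun x => frequently (fun n => - (e * INR n) <= bsum T f0 n x))).
  { intros e He.
    apply ae_mono with (2 := ae_and _ _ (Hbil (e / 4) ltac:(lra)) (Hback (e / 4) ltac:(lra))).
    intros x [H1 [N2 H2]] N.
    destruct (frequently_and_eventually _ _ H1 (eventually_and _ _
      (eventually_nat_ge (N + N2 + Z.abs_nat p)) (eventually_INR_ge
        ((- f0 x + 4 * (e * r) + e) / (e / 4)))) 0%nat)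
      as (n & _ & Hn & Hn2 & Hn3).
    exists (Z.to_nat (Z.of_nat n + p)). split; [lia|].
    specialize (H2 (S n) ltac:(lia)). rewrite S_INR in H2.
    rewrite (INR_IZR_INZ (Z.to_nat _)), Z2Nat.id by lia.
    rewrite !plus_IZR, mult_IZR in *. rewrite <- !INR_IZR_INZ in *.
    apply Rmult_le_compat_r with (r := e / 4) in Hn3; [|lra].
    unfold Rdiv at 1 in Hn3. rewrite Rmult_assoc, Rinv_l, Rmult_1_r in Hn3 by lra.
    assert (- (e * r) <= e * IZR p <= e * r) by (split; nra).
    lra. }
  assert (Hfreq' : forall e, 0 < e ->
    ae M mu (fun x => frequently (fun n => - (e * INR n) <= bsum Tinv f0 n x))).
  { intros e He.
    apply ae_mono with (2 := ae_and _ _ (Hbil (e / 4) ltac:(lra)) (Hup (e / 4) ltac:(lra))).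
    intros x [H1 [N2 H2]] N.
    destruct (frequently_and_eventually _ _ H1 (eventually_and _ _
      (eventually_nat_ge (N + N2 + Z.abs_nat p)) (eventually_INR_ge
        ((- f0 x + 4 * (e * r) + e) / (e / 4)))) 0%nat)
      as (n & _ & Hn & Hn2 & Hn3).
    exists (S n). split; [lia|].
    specialize (H2 (Z.to_nat (Z.of_nat n + p)) ltac:(lia)). rewrite S_INR.
    rewrite (INR_IZR_INZ (Z.to_nat _)), Z2Nat.id in H2 by lia.
    rewrite !plus_IZR, ?mult_IZR in *. rewrite <- !INR_IZR_INZ in *.
    apply Rmult_le_compat_r with (r := e / 4) in Hn3; [|lra].
    unfold Rdiv at 1 in Hn3. rewrite Rmult_assoc, Rinv_l, Rmult_1_r in Hn3 by lra.
    assert (- (e * r) <= e * IZR p <= e * r) by (split; nra).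
    lra. }
  intros e He. split.
  - apply ae_mono with (2 := ae_and _ _ (Hup e He)
      (lower_of_upper T Tinv HT Herg f0 Hf0 Hup Hback Hfreq e He)).
    intros x [H1 H2]. eapply eventually_mono; [|exact (eventually_and _ _ H1 H2)].
    intros n [H3 H4]. cbv beta in *. rewrite Hs in *. apply Rabs_le. lra.
  - apply ae_mono with (2 := ae_and _ _ (Hback e He)
      (lower_of_upper Tinv T (invertible_mpt_sym _ _ HT) (ergodic_sym _ _ HT Herg)
        f0 Hf0 Hback Hup Hfreq' e He)).
    intros x [H1 H2]. eapply eventually_mono; [|exact (eventually_and _ _ H1 H2)].
    intros n [H3 H4]. cbv beta in *. rewrite Hs in *. apply Rabs_le. lra.
Qed.

(** * The averages in terms of Birkhoff sums, and their limits *)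

Lemma iterZ_nonneg (n : nat) (x : X) : iterZ T Tinv (Z.of_nat n) x = Nat.iter n T x.
Proof. destruct n as [|n]; auto. simpl. now rewrite SuccNat2Pos.id_succ. Qed.

Lemma iterZ_nonpos (n : nat) (x : X) : iterZ T Tinv (- Z.of_nat n) x = Nat.iter n Tinv x.
Proof. destruct n as [|n]; auto. simpl. now rewrite SuccNat2Pos.id_succ. Qed.

Lemma iterZ_sub (k n : nat) (x : X) :
  iterZ T Tinv (Z.of_nat k - Z.of_nat n) x = Nat.iter k T (Nat.iter n Tinv x).
Proof.
  assert (H : (exists d, k = d + n)%nat \/ (exists d, n = k + d)%nat)
    by (destruct (Nat.le_gt_cases n k); [left; exists (k - n)%nat | right; exists (n - k)%nat];
        lia).
  destruct H as [[d ->]|[d ->]].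
  - replace (Z.of_nat (d + n) - Z.of_nat n)%Z with (Z.of_nat d) by lia.
    rewrite iterZ_nonneg, iter_add.
    pose proof (iter_cancel_l T Tinv HT n 0 x) as H1. rewrite Nat.add_0_r in H1.
    now rewrite H1.
  - replace (Z.of_nat k - Z.of_nat (k + d))%Z with (- Z.of_nat d)%Z by lia.
    now rewrite iterZ_nonpos, (iter_cancel_l T Tinv HT).
Qed.

Lemma Aplus_bsum (f : X -> R) (n : nat) (x : X) :
  Aplus T Tinv f n x = / INR n * bsum T f n x.
Proof.
  unfold Aplus, bsum. f_equal. apply sumn_ext. intros i _. now rewrite iterZ_nonneg.
Qed.

Lemma Aminus_bsum (f : X -> R) (n : nat) (x : X) :
  Aminus T Tinv f n x = / INR n * bsum Tinv f n x.
Proof.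
  unfold Aminus, bsum. f_equal. apply sumn_ext. intros i _. now rewrite iterZ_nonpos.
Qed.

Lemma Bq_bil (f : X -> R) (q : Z) (n : nat) (x : X) :
  Bq T Tinv f q n x = / IZR (2 * Z.of_nat n + (1 + q)) * bil f (1 + q) n x.
Proof.
  unfold Bq, bil, bsum. rewrite Z.add_assoc. f_equal. apply sumn_ext. intros i _.
  now rewrite iterZ_sub.
Qed.

Lemma Bsym_Bq (f : X -> R) (n : nat) (x : X) : Bsym T Tinv f n x = Bq T Tinv f 0 n x.
Proof.
  unfold Bsym, Bq. rewrite Z.add_0_r.
  replace (2 * Z.of_nat n + 1)%Z with (Z.of_nat (2 * n + 1)) by lia.
  now rewrite INR_IZR_INZ, Nat2Z.id.
Qed.

Lemma averages_converge (f : X -> R) (l : ExtR) (x : X) :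
  linear_growth (fun n => bsum T f n x) l -> linear_growth (fun n => bsum Tinv f n x) l ->
  tends_to (fun n => Aplus T Tinv f n x) l /\ tends_to (fun n => Aminus T Tinv f n x) l /\
  forall q, tends_to (fun n => Bq T Tinv f q n x) l.
Proof.
  intros Hu Hv. repeat split.
  - eapply tends_to_ext; [|exact (growth_average _ _ Hu)].
    exists 0%nat. intros n _. now rewrite Aplus_bsum.
  - eapply tends_to_ext; [|exact (growth_average _ _ Hv)].
    exists 0%nat. intros n _. now rewrite Aminus_bsum.
  - intros q. eapply tends_to_ext; [|exact (growth_bilateral _ _ (f x) (1 + q) _ Hu Hv)].
    exists (Z.abs_nat (1 + q)). intros n Hn. rewrite Bq_bil, bil_split by lia. reflexivity.
Qed.

(** The limit is the infimum of the levels [a] for which [bil_below f p a] has positive measure. If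
    it is finite, [one_sided_averages_limit] applies; otherwise arbitrarily low levels bound both
    one-sided sums. The limits of the one-sided averages then determine those for every [q']. *)
Lemma bilateral_bounded_converges (f : X -> R) (q : Z) (A : X -> Prop) :
  measurable_fun M f -> M A -> 0 < mu A ->
  (forall x, A x -> limsup_lt_pinf (fun n => Bq T Tinv f q n x)) ->
  exists c, c <> EPinf /\ ae M mu (fun x =>
    tends_to (fun n => Aplus T Tinv f n x) c /\ tends_to (fun n => Aminus T Tinv f n x) c /\
    forall q', tends_to (fun n => Bq T Tinv f q' n x) c).
Proof.
  intros Hf HA HposA Hsup. set (p := (1 + q)%Z).
  (* The sets for integer levels increase and their union contains [A], so one of them has positive
     measure. *)
  assert (Hm : exists m : nat, 0 < mu (bil_below f p (INR m))).
  { destruct (mu_below_gt (fun m => bil_below f p (INR m)) 0) as [m Hm].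
    - intros m. now apply meas_bil_below.
    - intros m x. apply bil_below_mono, le_INR. lia.
    - apply Rlt_le_trans with (1 := HposA). apply mu_mono; auto.
      + apply meas_ex. intros m. now apply meas_bil_below.
      + intros x Hx. destruct (Hsup x Hx) as (a & N & HN).
        destruct (INR_unbounded a) as [m Hm]. exists m.
        exists (N + Z.abs_nat p + 1)%nat. intros n Hn. specialize (HN n ltac:(lia)).
        rewrite Bq_bil in HN. fold p in HN.
        assert (HL : 0 < IZR (2 * Z.of_nat n + p)) by (apply IZR_lt; lia).
        apply Rmult_le_compat_l with (r := IZR (2 * Z.of_nat n + p)) in HN; [|lra].
        rewrite <- Rmult_assoc, Rinv_r, Rmult_1_l in HN by lra. nra.
    - exists m. apply Hm. lia. }
  destruct (classic (exists a0, forall a, 0 < mu (bil_below f p a) -> a0 <= a))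
    as [[a0 Ha0]|Hunb].
  - destruct (completeness (fun y => 0 < mu (bil_below f p (- y)))) as [s [Hub Hlub]].
    + exists (- a0). intros y Hy. apply Ha0 in Hy. lra.
    + destruct Hm as [m Hm]. exists (- INR m). now rewrite Ropp_involutive.
    + exists (EFin (- s)). split; [discriminate|].
      assert (Hab : forall e, 0 < e ->
        exists a, a < - s + e /\ 0 < mu (bil_below f p a)).
      { intros e He. apply NNPP. intros H. assert (s <= s - e); [|lra].
        apply Hlub. intros y Hy. apply Rnot_lt_le. intros Hlt. apply H.
        exists (- y). split; [lra | auto]. }
      assert (Hbe : forall e, 0 < e -> mu (bil_below f p (- s - e)) = 0).
      { intros e He. apply Rle_antisym; [|now apply mu_ge0, meas_bil_below].
        apply Rnot_lt_le. intros H. assert (s + e <= s); [|lra]. apply Hub.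
        replace (- (s + e)) with (- s - e) by ring. auto. }
      pose proof (one_sided_averages_limit f p (- s) Hf Hab Hbe) as Hlim.
      assert (Hmono : forall S e e' x, e <= e' ->
        eventually (fun n => Rabs (bsum S f n x - - s * INR n) <= e * INR n) ->
        eventually (fun n => Rabs (bsum S f n x - - s * INR n) <= e' * INR n)).
      { intros S e e' x Hee. apply eventually_mono. intros n H.
        pose proof (pos_INR n). nra. }
      apply ae_mono with (2 := ae_and _ _
        (ae_all_eps _ (Hmono T) (fun e He => proj1 (Hlim e He)))
        (ae_all_eps _ (Hmono Tinv) (fun e He => proj2 (Hlim e He)))).
      intros x [H1 H2]. now apply averages_converge.
  - exists EMinf. split; [discriminate|].
    assert (Hneg : forall m : nat, exists a, a < - INR m /\ 0 < mu (bil_below f p a)).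
    { intros m. apply NNPP. intros H. apply Hunb. exists (- INR m). intros a Ha.
      apply Rnot_lt_le. intros H1. apply H. now exists a. }
    assert (Hall : forall S, (forall m : nat, ae M mu (fun x =>
        eventually (fun n => bsum S f n x <= - INR m * INR n))) ->
      ae M mu (fun x => linear_growth (fun n => bsum S f n x) EMinf)).
    { intros S H. apply ae_mono with (2 := ae_all _ H). intros x Hx a.
      destruct (INR_unbounded (- a)) as [m Hm1]. eapply eventually_mono; [|exact (Hx m)].
      intros n Hn. pose proof (pos_INR n). simpl in Hn. nra. }
    apply ae_mono with (P := fun x => linear_growth (fun n => bsum T f n x) EMinf /\
      linear_growth (fun n => bsum Tinv f n x) EMinf).
    + intros x [H1 H2]. now apply averages_converge.
    + apply ae_and; apply Hall; intros m; destruct (Hneg m) as (a & Ha & Hpos).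
      * exact (forward_upper f p a _ Hf Ha Hpos).
      * exact (backward_upper f p a _ Hf Ha Hpos).
Qed.

Lemma Bq_opp (f : X -> R) (q : Z) (n : nat) (x : X) :
  Bq T Tinv (fun y => - f y) q n x = - Bq T Tinv f q n x.
Proof.
  unfold Bq. rewrite (sumn_ext _ (fun k => - f _)
    (fun k => -1 * f (iterZ T Tinv (Z.of_nat k - Z.of_nat n) x))) by (intros; ring).
  rewrite sumn_scal. ring.
Qed.

Lemma meas_Bq_bounded (f : X -> R) (q : Z) : measurable_fun M f ->
  M (fun x => exists m : nat, eventually (fun n => Bq T Tinv f q n x <= INR m)).
Proof.
  intros Hf. apply meas_ex; intros m.
  apply (meas_eventually (fun n x => Bq T Tinv f q n x <= INR m)). intros n.
  apply meas_le; [|apply mfun_const].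
  replace (Bq T Tinv f q n)
    with (fun x => / IZR (2 * Z.of_nat n + (1 + q)) * bil f (1 + q) n x)
    by (apply functional_extensionality; intros x; now rewrite Bq_bil).
  now apply mfun_scal, mfun_bil.
Qed.

(* A limit is either [< +oo] or [> -oo], so one of [f], [- f] has bilateral averages bounded
   above on a set of positive measure. *)
Lemma Bq_convergence_transfer (f : X -> R) (q q' : Z) : measurable_fun M f ->
  ae M mu (fun x => exists l, tends_to (fun n => Bq T Tinv f q n x) l) ->
  ae M mu (fun x => exists l, tends_to (fun n => Bq T Tinv f q' n x) l).
Proof.
  intros Hf Hconv.
  set (U := fun (g : X -> R) x =>
    exists m : nat, eventually (fun n => Bq T Tinv g q n x <= INR m)).
  assert (HU : forall g x, U g x -> limsup_lt_pinf (fun n => Bq T Tinv g q n x)).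
  { intros g x (m & N & HN). exists (INR m), N. exact HN. }
  assert (HU' : forall g x, limsup_lt_pinf (fun n => Bq T Tinv g q n x) -> U g x).
  { intros g x (a & N & HN). destruct (INR_unbounded a) as [m Hm]. exists m, N.
    intros n Hn. specialize (HN n Hn). simpl in HN. lra. }
  set (f' := fun y => - f y). assert (Hf' : measurable_fun M f') by now apply mfun_opp.
  pose proof (meas_Bq_bounded f q Hf) as HM1. pose proof (meas_Bq_bounded f' q Hf') as HM2.
  fold (U f) in HM1. fold (U f') in HM2.
  assert (Hor : mu (fun x => U f x \/ U f' x) = 1).
  { apply mu1_of_ae; [now apply meas_or|]. apply ae_mono with (2 := Hconv). intros x [l Hl].
    destruct (classic (l = EPinf)) as [E|E].
    - right. apply HU', limsup_lt_pinf_of_tends with (ext_opp l); [now subst|].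
      eapply tends_to_ext; [|exact (tends_to_opp _ _ Hl)].
      exists 0%nat. intros n _. symmetry. apply Bq_opp.
    - left. apply HU'. now apply limsup_lt_pinf_of_tends with l. }
  pose proof (mu_union_le (U f) (U f') HM1 HM2) as Hle.
  destruct (Rlt_le_dec 0 (mu (U f))) as [Hpos|H0].
  - destruct (bilateral_bounded_converges f q (U f) Hf HM1 Hpos (HU f)) as (c & _ & Hc).
    apply ae_mono with (2 := Hc). intros x (_ & _ & H). exists c. apply H.
  - destruct (bilateral_bounded_converges f' q (U f') Hf' HM2 ltac:(lra) (HU f'))
      as (c & _ & Hc).
    apply ae_mono with (2 := Hc). intros x (_ & _ & H). exists (ext_opp c).
    eapply tends_to_ext; [|exact (tends_to_opp _ _ (H q'))].
    exists 0%nat. intros n _. unfold f'. rewrite Bq_opp. ring.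
Qed.

End Bilateral.
End MeasureSpace.

Theorem theorem3 (X : Type) (M : (X -> Prop) -> Prop) (mu : (X -> Prop) -> R)
  (T Tinv : X -> X)
  (HM : sigma_algebra M) (Hmu : probability_measure M mu)
  (HT : invertible_mpt M mu T Tinv) (Herg : ergodic M mu T)
  (f : X -> R) (Hf : measurable_fun M f) (q : Z) :
  ((exists A, M A /\ 0 < mu A /\
      forall x, A x -> limsup_lt_pinf (fun n => Bq T Tinv f q n x)) ->
   exists c : ExtR, c <> EPinf /\
     ae M mu (fun x =>
       tends_to (fun n => Aplus T Tinv f n x) c /\
       tends_to (fun n => Aminus T Tinv f n x) c /\
       tends_to (fun n => Bsym T Tinv f n x) c /\
       tends_to (fun n => Bq T Tinv f q n x) c))
  /\
  (ae M mu (fun x => exists l : ExtR, tends_to (fun n => Bsym T Tinv f n x) l) <->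
   ae M mu (fun x => exists l : ExtR, tends_to (fun n => Bq T Tinv f q n x) l)).
Proof.
  (* The symmetric average is the case [q = 0], so the equivalence is the transfer between 0 and [q]
     in both directions. *)
  assert (Hsym : forall x, (fun n => Bsym T Tinv f n x) = (fun n => Bq T Tinv f 0 n x)).
  { intros x. apply functional_extensionality. intros n. apply Bsym_Bq. }
  pose proof (Bq_convergence_transfer M mu HM Hmu T Tinv HT Herg f) as Htr.
  split; [|split].
  - intros (A & HA & Hpos & Hsup).
    destruct (bilateral_bounded_converges M mu HM Hmu T Tinv HT Herg f q A Hf HA Hpos Hsup)
      as (c & Hc & Hae).
    exists c. split; auto. destruct Hae as (N & HN & HN0 & H). exists N.
    split; [|split]; auto. intros x Hx. destruct (H x Hx) as (H1 & H2 & H3).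
    rewrite Hsym. auto.
  - intros H. apply (Htr 0%Z q Hf). destruct H as (N & HN & HN0 & H). exists N.
    split; [|split]; auto. intros x Hx. rewrite <- Hsym. auto.
  - intros H. destruct (Htr q 0%Z Hf H) as (N & HN & HN0 & H'). exists N.
    split; [|split]; auto. intros x Hx. rewrite Hsym. auto.
Qed.
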